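(* Let $f:\mathbb{R}^n\to\mathbb{R}$ be $C^2$ and bounded below, with $\|\nabla f(x)-\nabla f(y)\|\le L\|x-y\|$ and $\|\nabla^2 f(x)-\nabla^2 f(y)\|\le M\|x-y\|$ for all $x,y\in\mathbb{R}^n$. Let $$0<\varepsilon\le \frac{M^2}{8},\qquad \delta=\Big(\sqrt{n/s}+\mathcal{C}\Big)^2\sqrt{\varepsilon},\qquad \Delta=\frac{\sqrt{\varepsilon}}{M}.$$ Suppose that the output $x^*$ of the algorithm RSHTR, run from $x_0$ with subspace dimension $s$ and parameters $\delta,\Delta$, satisfies $r:=\mathrm{rank}(\nabla^2 f(x^* ))\le s$. If there is a constant $\tau>0$ such that $s=O(n\,\varepsilon^{1/\tau})$, then RSHTR outputs an $\varepsilon$-SOSP in at most $O(\varepsilon^{-3/2})$ iterations with probability at least $$1-6\exp(-Cs/4)-(2U_\varepsilon+4)\exp(-s)-\exp(-s+r-1)-\exp(-\bar c s),$$ where $\bar c$ and $C$ are absolute constants and $U_\varepsilon:=\big\lfloor 3M^2\big(f(x_0)-\inf_{x\in\mathbb{R}^n}f(x)\big)\varepsilon^{-3/2}\big\rfloor+1$.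
   Context: Algorithm RSHTR (parameters: subspace dimension $s\ll n$, $\delta\ge 0$, $\Delta>0$). At iteration $k$, with current point $x_k$, $g_k=\nabla f(x_k)$, $H_k=\nabla^2 f(x_k)$: draw a random matrix $P_k\in\mathbb{R}^{s\times n}$ with i.i.d. $\mathcal{N}(0,1/s)$ entries, independently of all previous draws; set $\tilde g_k=P_kg_k$, $\tilde H_k=P_kH_kP_k^\top$; let $(\tilde v_k,t_k)\in\mathbb{R}^s\times\mathbb{R}$ be an exact minimizer of $$\min_{\|[\tilde v;t]\|\le 1}\begin{bmatrix}\tilde v\\ t\end{bmatrix}^\top\begin{bmatrix}\tilde H_k&\tilde g_k\\ \tilde g_k^\top&-\delta\end{bmatrix}\begin{bmatrix}\tilde v\\ t\end{bmatrix};$$ set $d_k=P_k^\top\tilde v_k/t_k$ if $t_k\neq0$ and $d_k=P_k^\top\tilde v_k$ if $t_k=0$. If $\|d_k\|>\Delta$, set $x_{k+1}=x_k+\frac{\Delta}{\|d_k\|}d_k$ and continue; if $\|d_k\|\le\Delta$, terminate and output $x^*=x_k$. (The iteration cap is taken large enough not to interfere.) Absolute constants: $\mathcal{C}$ is such that a random $s\times n$ matrix $P$ with i.i.d. $\mathcal{N}(0,1/s)$ entries satisfies, with probability at least $1-2e^{-s}$, $(\sqrt{n/s}-\mathcal{C})\|y\|\le\|P^\top y\|\le(\sqrt{n/s}+\mathcal{C})\|y\|$ for all $y\in\mathbb{R}^s$. $C$ is such that for each fixed $x\in\mathbb{R}^n$ and $\xi\in(0,1)$, $(1-\xi)\|x\|\le\|Px\|\le(1+\xi)\|x\|$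 with probability at least $1-2\exp(-C\xi^2s)$. $\bar c$ is the constant in the Rudelson–Vershynin bound: for an $s\times r$ matrix $A$ ($1\le r\le s$) with i.i.d. $\mathcal{N}(0,1/s)$ entries, $\Pr[\sigma_{\min}(A)\ge\zeta(1-\sqrt{(r-1)/s})]\ge 1-(\bar C\zeta)^{s-r+1}-e^{-\bar c s}$ for all $\zeta>0$. Conventions: $s=O(n\varepsilon^{1/\tau})$ means $s\le c\,n\varepsilon^{1/\tau}$ for a constant $c>0$. A point $\hat x$ is an $\varepsilon$-SOSP if $\|\nabla f(\hat x)\|\le O(\varepsilon)$ and $\lambda_{\min}(\nabla^2f(\hat x))\ge\Omega(-\sqrt\varepsilon)$. With the dependence on $n/s$ made explicit, this means $\|\nabla f(\hat x)\|\le K(n/s)^{(2+\tau)/2}\varepsilon$ and $\lambda_{\min}(\nabla^2 f(\hat x))\ge -K'(n/s)\sqrt\varepsilon$, where $K$ depends only on $L,M,\tau,c$ and absolute constants, and $K'$ only on $L,M,r,s$ and absolute constants. The constant in $O(\varepsilon^{-3/2})$ depends only on $M$ and $f(x_0)-\inf f$. The standing assumption $s\ll n$ means that $n/s$ is at least a suitable absolute constant (in particular $\sqrt{n/s}>\mathcal{C}$). *)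

(* Defs.v *)
From HB Require Import structures.
From mathcomp Require Import all_boot all_order all_algebra.
From mathcomp Require Import all_classical all_reals all_analysis.

Set Implicit Arguments.
Unset Strict Implicit.
Unset Printing Implicit Defensive.

Import Order.TTheory GRing.Theory Num.Theory.
Import numFieldNormedType.Exports.

Local Open Scope classical_set_scope.
Local Open Scope ring_scope.

(* The norm `|x| that the library puts on matrices is the max norm, hence the
   separate Euclidean and operator norms. *)
Definition enorm (R : realType) (n : nat) (x : 'cV[R]_n) : R :=
  Num.sqrt (\sum_i x i 0 ^+ 2).

Definition opnorm (R : realType) (m n : nat) (A : 'M[R]_(m, n)) : R :=
  sup [set enorm (A *m v) | v in [set v : 'cV[R]_n | enorm v <= 1]].

(* Meaningful for a symmetric matrix of size at least 1, whose set of
   eigenvalues is finite and nonempty. *)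
Definition lambda_min (R : realType) (n : nat) (A : 'M[R]_n) : R :=
  inf [set a : R | eigenvalue A a].

(* Smallest singular value of a matrix with at least as many rows as columns. *)
Definition sigma_min (R : realType) (m n : nat) (A : 'M[R]_(m, n)) : R :=
  Num.sqrt (lambda_min (A^T *m A)).

Definition grad (R : realType) (n : nat) (f : 'cV[R]_n -> R) (x : 'cV[R]_n)
  : 'cV[R]_n :=
  \col_i 'D_(delta_mx i 0 : 'cV[R]_n) f x.

Definition hess (R : realType) (n : nat) (f : 'cV[R]_n -> R) (x : 'cV[R]_n)
  : 'M[R]_n :=
  \matrix_(i, j) 'D_(delta_mx j 0 : 'cV[R]_n) (fun y => grad f y i 0) x.

Definition C2 (R : realType) (n : nat) (f : 'cV[R]_n -> R) : Prop :=
  [/\ forall x, differentiable f x,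
      forall x, differentiable (grad f) x
    & continuous (hess f)].

(* "A holds with probability at least p", without requiring A itself to be
   measurable. *)
Definition prob_ge (R : realType) (d : measure_display) (T : measurableType d)
    (Pr : probability T R) (A : set T) (p : R) : Prop :=
  exists E : set T, [/\ measurable E, E `<=` A & (p%:E <= Pr E)%E].

(* The sigma-algebra on T generated by the entries of a random matrix. *)
Definition sigma_mx (R : realType) (T : Type) (m n : nat)
    (X : T -> 'M[R]_(m, n)) : set (set T) :=
  <<s [set A | exists i j, exists2 B : set R,
         measurable B & A = (fun w => X w i j) @^-1` B] >>.

(* Random m x n matrices with i.i.d. N(0, 1/m) entries; the second argument of
   normal_prob is the standard deviation. *)
Definition gaussian_mx (R : realType) (d : measure_display)
    (T : measurableType d) (Pr : probability T R) (m n : nat)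
    (X : T -> 'M[R]_(m, n)) : Prop :=
  [/\ forall i j, measurable_fun setT (fun w => X w i j),
      forall i j (B : set R), measurable B ->
        Pr ((fun w => X w i j) @^-1` B) =
        normal_prob 0 (Num.sqrt (m%:R^-1)) B
    & forall B : 'I_m -> 'I_n -> set R, (forall i j, measurable (B i j)) ->
        Pr [set w | forall i j, B i j (X w i j)] =
        (\prod_(i < m) \prod_(j < n) Pr ((fun w => X w i j) @^-1` B i j))%E].

(* Defining properties of the absolute constants; CC is the constant written
   with a calligraphic C in the definition of delta. *)
Definition norm_constant (R : realType) (CC : R) : Prop :=
  forall (n s : nat) (d : measure_display) (T : measurableType d)
    (Pr : probability T R) (P : T -> 'M[R]_(s, n)),
  (0 < s <= n)%N -> gaussian_mx Pr P ->
  prob_ge Pr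
    [set w | forall y : 'cV[R]_s,
       (Num.sqrt (n%:R / s%:R) - CC) * enorm y <= enorm ((P w)^T *m y)
         <= (Num.sqrt (n%:R / s%:R) + CC) * enorm y]
    (1 - 2 * expR (- s%:R)).

Definition JL_constant (R : realType) (C : R) : Prop :=
  forall (n s : nat) (d : measure_display) (T : measurableType d)
    (Pr : probability T R) (P : T -> 'M[R]_(s, n)) (x : 'cV[R]_n) (xi : R),
  (0 < s <= n)%N -> gaussian_mx Pr P -> 0 < xi < 1 ->
  prob_ge Pr
    [set w | (1 - xi) * enorm x <= enorm (P w *m x) <= (1 + xi) * enorm x]
    (1 - 2 * expR (- (C * xi ^+ 2 * s%:R))).

Definition RV_constants (R : realType) (Cbar cbar : R) : Prop :=
  forall (s r : nat) (d : measure_display) (T : measurableType d)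
    (Pr : probability T R) (A : T -> 'M[R]_(s, r)) (zeta : R),
  (1 <= r <= s)%N -> gaussian_mx Pr A -> 0 < zeta ->
  prob_ge Pr
    [set w | zeta * (1 - Num.sqrt (r.-1%:R / s%:R)) <= sigma_min (A w)]
    (1 - (Cbar * zeta) ^+ (s - r).+1 - expR (- (cbar * s%:R))).

(* The pair [v; t] of the subproblem is kept as one column vector z of size
   s + 1. *)
Definition sub_mx (R : realType) (n s : nat) (g : 'cV[R]_n) (H : 'M[R]_n)
    (delta : R) (P : 'M[R]_(s, n)) : 'M[R]_(s + 1) :=
  block_mx (P *m H *m P^T) (P *m g) (P *m g)^T (- delta)%:M.

Definition ball_minimizer (R : realType) (m : nat) (F : 'M[R]_m)
    (z : 'cV[R]_m) : Prop :=
  enorm z <= 1 /\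
  forall y : 'cV[R]_m, enorm y <= 1 ->
    (z^T *m F *m z) 0 0 <= (y^T *m F *m y) 0 0.

Definition direction (R : realType) (n s : nat) (P : 'M[R]_(s, n))
    (z : 'cV[R]_(s + 1)) : 'cV[R]_n :=
  let v := usubmx z in
  let t := dsubmx z 0 0 in
  if t != 0 then t^-1 *: (P^T *m v) else P^T *m v.

(* Iteration k is reached when none of the iterations 0, ..., k - 1 has
   terminated. *)
Definition reached (R : realType) (T : Type) (n s : nat) (Delta : R)
    (P : nat -> T -> 'M[R]_(s, n)) (z : nat -> T -> 'cV[R]_(s + 1))
    (k : nat) (w : T) : Prop :=
  forall j, (j < k)%N -> Delta < enorm (direction (P j w) (z j w)).

Definition outputs_at (R : realType) (T : Type) (n s : nat) (Delta : R)
    (P : nat -> T -> 'M[R]_(s, n)) (z : nat -> T -> 'cV[R]_(s + 1))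
    (k : nat) (w : T) : Prop :=
  reached Delta P z k w /\ enorm (direction (P k w) (z k w)) <= Delta.

Definition past (R : realType) (T : Type) (n s : nat)
    (P : nat -> T -> 'M[R]_(s, n)) (z : nat -> T -> 'cV[R]_(s + 1))
    (k : nat) : set (set T) :=
  <<s \bigcup_(j in [set j | (j < k)%N]) (sigma_mx (P j) `|` sigma_mx (z j)) >>.

(* A subproblem may have several minimizers.  Any choice z k that is a random
   variable is allowed; P k is independent of all earlier draws and choices.
   P, z and x are indexed by all of nat, but the values of z and x are
   constrained only at the iterations that are reached. *)
Record RSHTR_run (R : realType) (d : measure_display) (T : measurableType d)
    (Pr : probability T R) (n s : nat) (f : 'cV[R]_n -> R) (x0 : 'cV[R]_n)
    (delta Delta : R) (P : nat -> T -> 'M[R]_(s, n))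
    (z : nat -> T -> 'cV[R]_(s + 1)) (x : nat -> T -> 'cV[R]_n) : Prop := {
  run_gaussian : forall k, gaussian_mx Pr (P k);
  run_indep : forall k (A B : set T), past P z k A -> sigma_mx (P k) B ->
    Pr (A `&` B) = (Pr A * Pr B)%E;
  run_measurable : forall k i, measurable_fun setT (fun w => z k w i 0);
  run_minimizer : forall k w, reached Delta P z k w ->
    ball_minimizer
      (sub_mx (grad f (x k w)) (hess f (x k w)) delta (P k w)) (z k w);
  run_start : forall w, x 0%N w = x0;
  run_step : forall k w, reached Delta P z k.+1 w ->
    x k.+1 w = x k w + (Delta / enorm (direction (P k w) (z k w)))
                         *: direction (P k w) (z k w)
}.

(* Main.v *)
Require Import Defs.
From HB Require Import structures.
From mathcomp Require Import all_boot all_order all_algebra.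
From mathcomp Require Import all_classical all_reals all_analysis.
From mathcomp Require Import measurable_realfun.
From mathcomp Require Import ring lra zify.

Set Implicit Arguments.
Unset Strict Implicit.
Unset Printing Implicit Defensive.

Import Order.TTheory GRing.Theory Num.Theory.
Import numFieldNormedType.Exports.

Local Open Scope classical_set_scope.
Local Open Scope ring_scope.

(** At an iteration that does not stop, the eigenvector equation of the
    homogenized subproblem and the cubic Taylor bound decrease f by at least
    eps^(3/2) / (3 M^2) as soon as the upper bound on P^T holds, so on the norm
    events of the first U iterations the run stops before iteration U.

    At the stopping point, P g = O(nu sqrt eps) and P H P^T >= - O(nu sqrt eps).
    These bounds transfer to g and H provided P does not shrink g nor any vector
    in the range of H too much.  The stopping iteration depends on the draws, so
    this has to hold at all U iterations at once.  The claim is void unless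
    U <= e^s / 2; it is therefore enough that each iteration fails with
    probability O(e^(-2s)), which the constants K and K' can be chosen to ensure:
    |P u| <= al |u| has probability at most (2 al)^s, by the Laplace transform
    of |P u|^2, and a net of the range of H, of dimension at most s, reduces the
    second requirement to this estimate.  The last two estimates are for a fixed
    vector or matrix; Fubini transfers them to g and H, which depend only on the
    past and are independent of the current P. *)

(** * Euclidean geometry of matrices *)

(** The stopping test by itself only gives a gradient of order nu sqrt eps. The missing half power
    of eps comes from the size condition on [s]: s <= c n eps^(1/tau) says 1 <= c nu eps^(1/tau),
    and raising this to the power tau/2 gives sqrt eps <= c^(tau/2) nu^(tau/2) eps, whence the
    exponent (2 + tau)/2 of nu.

    The level e^(-2s) is dictated by the probability budget. Over U iterations the norm events cost
    2U e^(-s), a term of the claimed bound; the two other events, at e^(-2s) each, cost 2U e^(-2s) <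
    e^(-s), which fits into 4 e^(-s). Near-isometry on a fixed vector is only guaranteed up to
    probability 2 exp(-C xi^2 s), which need not be small against 1/U. Hence [P] is allowed to
    shrink lengths substantially: by the absolute factor [al] on the gradient, and on the range of
    the Hessian by a factor that depends on [s] alone, so that neither constant sees [n]. *)

Definition dot (R : realType) (n : nat) (u v : 'cV[R]_n) : R :=
  \sum_i u i 0 * v i 0.

Section Euclidean.
Context {R : realType}.
Implicit Types (n m : nat).

Lemma dot_mx n (u v : 'cV[R]_n) : (u^T *m v) 0 0 = dot u v.
Proof. by rewrite mxE; apply: eq_bigr => i _; rewrite mxE. Qed.

Lemma dotC n (u v : 'cV[R]_n) : dot u v = dot v u.
Proof. by apply: eq_bigr => i _; rewrite mulrC. Qed.

Lemma dotDl n (u v w : 'cV[R]_n) : dot (u + v) w = dot u w + dot v w.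
Proof. by rewrite -big_split; apply: eq_bigr => i _; rewrite mxE mulrDl. Qed.

Lemma dotDr n (u v w : 'cV[R]_n) : dot w (u + v) = dot w u + dot w v.
Proof. by rewrite dotC dotDl ![dot _ w]dotC. Qed.

Lemma dotZl n a (u v : 'cV[R]_n) : dot (a *: u) v = a * dot u v.
Proof. by rewrite /dot mulr_sumr; apply: eq_bigr => i _; rewrite mxE mulrA. Qed.

Lemma dotZr n a (u v : 'cV[R]_n) : dot u (a *: v) = a * dot u v.
Proof. by rewrite dotC dotZl dotC. Qed.

Lemma dotNl n (u v : 'cV[R]_n) : dot (- u) v = - dot u v.
Proof. by rewrite -scaleN1r dotZl mulN1r. Qed.

Lemma dotNr n (u v : 'cV[R]_n) : dot u (- v) = - dot u v.
Proof. by rewrite dotC dotNl dotC. Qed.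

Lemma dot0l n (v : 'cV[R]_n) : dot 0 v = 0.
Proof. by rewrite -(scale0r 0) dotZl mul0r. Qed.

Lemma dot_mulmxl m n (A : 'M[R]_(m, n)) (u : 'cV[R]_n) (v : 'cV[R]_m) :
  dot (A *m u) v = dot u (A^T *m v).
Proof. by rewrite -!dot_mx trmx_mul mulmxA. Qed.

Lemma dot_col_mx m n (u u' : 'cV[R]_m) (v v' : 'cV[R]_n) :
  dot (col_mx u v) (col_mx u' v') = dot u u' + dot v v'.
Proof. by rewrite -!dot_mx tr_col_mx mul_row_col mxE. Qed.

Lemma dot_ge0 n (u : 'cV[R]_n) : 0 <= dot u u.
Proof. by apply: sumr_ge0 => i _; rewrite -expr2 sqr_ge0. Qed.

Lemma enormE n (u : 'cV[R]_n) : enorm u = Num.sqrt (dot u u).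
Proof. by congr Num.sqrt; apply: eq_bigr => i _; rewrite expr2. Qed.

Lemma sqr_enorm n (u : 'cV[R]_n) : enorm u ^+ 2 = dot u u.
Proof. by rewrite enormE sqr_sqrtr // dot_ge0. Qed.

Lemma enorm_ge0 n (u : 'cV[R]_n) : 0 <= enorm u.
Proof. exact: sqrtr_ge0. Qed.

Lemma enorm0 n : enorm (0 : 'cV[R]_n) = 0.
Proof. by rewrite enormE dot0l sqrtr0. Qed.

Lemma enorm_eq0 n (u : 'cV[R]_n) : (enorm u == 0) = (u == 0).
Proof.
apply/idP/eqP => [|->]; last by rewrite enorm0.
rewrite -sqrf_eq0 sqr_enorm psumr_eq0 => [|i _]; last by rewrite -expr2 sqr_ge0.
move=> /allP h; apply/colP => i; rewrite mxE.
by have := h i (mem_index_enum i); rewrite -expr2 sqrf_eq0 => /eqP.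
Qed.

Lemma enorm_gt0 n (u : 'cV[R]_n) : (0 < enorm u) = (u != 0).
Proof. by rewrite lt0r enorm_eq0 enorm_ge0 andbT. Qed.

Lemma enormZ n a (u : 'cV[R]_n) : enorm (a *: u) = `|a| * enorm u.
Proof.
by rewrite !enormE dotZl dotZr mulrA -expr2 sqrtrM ?sqr_ge0 // sqrtr_sqr.
Qed.

Lemma enormN n (u : 'cV[R]_n) : enorm (- u) = enorm u.
Proof. by rewrite -scaleN1r enormZ normrN1 mul1r. Qed.

Lemma cauchy_schwarz n (u v : 'cV[R]_n) : `|dot u v| <= enorm u * enorm v.
Proof.
have [->|v0] := eqVneq v 0; first by rewrite dotC dot0l enorm0 normr0 mulr0.
have vv : 0 < dot v v by rewrite -sqr_enorm exprn_gt0 // enorm_gt0.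
rewrite -(@ler_pXn2r _ 2) ?nnegrE ?mulr_ge0 ?enorm_ge0 //.
rewrite exprMn !sqr_enorm real_normK ?num_real //.
have := dot_ge0 (dot v v *: u - dot u v *: v).
rewrite !(dotDl, dotDr, dotNl, dotNr, dotZl, dotZr) (dotC v u) => h.
rewrite -(ler_pM2l vv) -subr_ge0.
suff -> : dot v v * (dot u u * dot v v) - dot v v * dot u v ^+ 2 =
  dot v v * (dot v v * dot u u) - dot u v * (dot v v * dot u v)
  - (dot v v * (dot u v * dot u v) - dot u v * (dot u v * dot v v)) by lra.
by ring.
Qed.

Lemma dot_le_enorm n (u v : 'cV[R]_n) : dot u v <= enorm u * enorm v.
Proof. exact: le_trans (ler_norm _) (cauchy_schwarz u v). Qed.

Lemma enormD n (u v : 'cV[R]_n) : enorm (u + v) <= enorm u + enorm v.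
Proof.
rewrite -(@ler_pXn2r _ 2) ?nnegrE ?addr_ge0 ?enorm_ge0 //.
rewrite sqr_enorm dotDl !dotDr sqrrD !sqr_enorm (dotC v u).
by have := dot_le_enorm u v; lra.
Qed.

Lemma enormB n (u v : 'cV[R]_n) : enorm (u - v) <= enorm u + enorm v.
Proof. by rewrite (le_trans (enormD _ _)) // enormN. Qed.

Lemma enorm_sum n (I : finType) (F : I -> 'cV[R]_n) :
  enorm (\sum_i F i) <= \sum_i enorm (F i).
Proof.
elim/big_ind2: _ => //; first by rewrite enorm0.
by move=> ? ? ? ? h1 h2; rewrite (le_trans (enormD _ _)) // lerD.
Qed.

Lemma dot_eq_r n (u v : 'cV[R]_n) : (forall y, dot y u = dot y v) -> u = v.
Proof.
move=> h; apply/eqP; rewrite -subr_eq0 -enorm_eq0 -sqrf_eq0 sqr_enorm.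
by rewrite {2}(_ : u - v = u + - v) // dotDr dotNr h subrr.
Qed.

(** A matrix and its transpose have the same operator norm: |A x|^2 pairs x with A^T A x. This
    carries the upper bound known for P^T over to P. *)
Lemma enorm_mulmx_trmx m n (A : 'M[R]_(m, n)) (b : R) : 0 <= b ->
  (forall y, enorm (A^T *m y) <= b * enorm y) ->
  forall x, enorm (A *m x) <= b * enorm x.
Proof.
move=> b0 h x; have [->|Ax0] := eqVneq (A *m x) 0.
  by rewrite enorm0 mulr_ge0 // enorm_ge0.
rewrite -(@ler_pM2r _ (enorm (A *m x))) ?enorm_gt0 // -expr2 sqr_enorm.
rewrite dot_mulmxl (le_trans (dot_le_enorm _ _)) //.
by rewrite [b * _]mulrC -mulrA ler_wpM2l ?enorm_ge0.
Qed.

(* The minimum is attained on the sphere, at an eigenvector of the smallest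
   eigenvalue -th. *)
Lemma ball_minimizer_kkt m (F : 'M[R]_m) (z y0 : 'cV[R]_m) : F^T = F ->
  ball_minimizer F z -> enorm y0 <= 1 -> dot y0 (F *m y0) < 0 ->
  exists th, [/\ th >= - dot y0 (F *m y0), F *m z = - th *: z, enorm z = 1 &
    forall y, - th * enorm y ^+ 2 <= dot y (F *m y)].
Proof.
move=> Fsym [z1 zmin] y01 y0neg.
have qE y : (y^T *m F *m y) 0 0 = dot y (F *m y) by rewrite -mulmxA dot_mx.
pose th := - dot z (F *m z).
have thy0 : - th <= dot y0 (F *m y0) by rewrite /th opprK -!qE zmin.
have lb y : - th * enorm y ^+ 2 <= dot y (F *m y).
  have [->|y_neq0] := eqVneq y 0; first by rewrite enorm0 dot0l expr0n mulr0.
  have ny : 0 < enorm y by rewrite enorm_gt0.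
  have := zmin ((enorm y)^-1 *: y); rewrite !qE enormZ normfV gtr0_norm //.
  rewrite mulVf ?gt_eqF // lexx => /(_ isT).
  rewrite -scalemxAr dotZl dotZr mulrA -expr2 -[X in X <= _]opprK -/th.
  by rewrite exprVn ler_pdivlMl ?exprn_gt0 // mulrC.
(* [lb] at z reads -th |z|^2 <= -th, and th > 0 because of [y0], so |z| cannot be below 1. *)
have zE : enorm z = 1.
  apply/eqP; rewrite eq_le z1 /= -(@ler_pXn2r _ 2) ?nnegrE ?enorm_ge0 //.
  have := lb z; rewrite /th opprK expr1n => h.
  rewrite leNgt; apply/negP => h'.
  have : dot z (F *m z) < 0 by move: thy0; rewrite /th opprK; lra.
  by nra.
exists th; split => //; first by lra.
apply: dot_eq_r => y; rewrite dotZr.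
set b := dot y (F *m z); set e := dot y z.
have bE : dot z (F *m y) = b by rewrite dotC dot_mulmxl Fsym.
(* The form of F + th is nonnegative and vanishes at z, so its expansion at z + t y has no constant
   term; the linear coefficient must then be 0. *)
have quad t : 0 <= 2 * t * (b + th * e)
    + t ^+ 2 * (dot y (F *m y) + th * dot y y).
  have := lb (z + t *: y); rewrite sqr_enorm mulmxDr -scalemxAr.
  rewrite !(dotDl, dotDr, dotZl, dotZr) bE -/b (dotC z y) -/e -[dot z z]sqr_enorm zE.
  have -> : dot z (F *m z) = - th by rewrite opprK.
  rewrite -subr_ge0 => h; apply: (le_trans h); rewrite le_eqVlt; apply/orP; left.
  by apply/eqP; ring.
set q := dot y (F *m y) + th * dot y y in quad.
have q0 : 0 <= q by have := lb y; rewrite sqr_enorm /q; lra.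
suff : (b + th * e) ^+ 2 <= 0.
  rewrite le_eqVlt ltNge sqr_ge0 orbF sqrf_eq0 => /eqP; lra.
(* The optimal t would have denominator q; taking q + 1 also covers q = 0. *)
have := quad (- (b + th * e) / (q + 1)).
have q1 : 0 < (q + 1)^-1 by rewrite invr_gt0; lra.
have qV : q * (q + 1)^-1 = 1 - (q + 1)^-1.
  by field; rewrite gt_eqF //; lra.
set i := (q + 1)^-1 in q1 qV *; set a := b + th * e.
have -> : 2 * (- a * i) * a + (- a * i) ^+ 2 * q
  = - 2 * a ^+ 2 * i + a ^+ 2 * i * (q * i) by ring.
rewrite qV => h; have i1 : 0 < i * (1 + i) by rewrite mulr_gt0 // addr_gt0.
by rewrite -(pmulr_lle0 _ i1); lra.
Qed.

(* With y = P H w and H P^T P H w = H q, the vector P^T y agrees with q up to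
   ker H, so P H P^T has at y the same quadratic form as H at q. *)
Lemma eigenvalue_compress n s (H : 'M[R]_n) (P : 'M[R]_(s, n)) (th tau a : R)
    (q : 'cV[R]_n) : H^T = H -> 0 < tau -> 0 <= th ->
  (forall w, tau * enorm (H *m w) <= enorm (P *m (H *m w))) ->
  (forall y, - th * enorm y ^+ 2 <= dot y (P *m H *m P^T *m y)) ->
  q != 0 -> H *m q = a *: q -> - (th / tau ^+ 2) <= a.
Proof.
move=> Hsym tau0 th0 inj psd q0 Hq.
pose B := H *m P^T *m P *m H.
(* If B kills u then |P H u|^2 = 0, and the lower bound on the range of H gives H u = 0. *)
have kerBH : (kermx B <= kermx H)%MS.
  apply/sub_kermxP/row_matrixP => i; rewrite row_mul row0.
  set u := row i (kermx B); apply: trmx_inj; rewrite trmx_mul trmx0 Hsym.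
  have uB : B *m u^T = 0.
    have := mulmx_ker B => /(congr1 (row i)); rewrite row_mul row0 -/u.
    by move=> /(congr1 trmx); rewrite trmx_mul /B !trmx_mul trmxK Hsym trmx0 !mulmxA.
  have PHu : enorm (P *m (H *m u^T)) ^+ 2 = 0.
    rewrite sqr_enorm dot_mulmxl dot_mulmxl Hsym !mulmxA -/B.
    by rewrite uB dotC dot0l.
  apply/eqP; rewrite -enorm_eq0; have := inj u^T.
  move/eqP: PHu; rewrite sqrf_eq0 => /eqP ->; have := enorm_ge0 (H *m u^T).
  by move=> h1 h2; apply/eqP; nra.
(* The kernel inclusion bounds the rank of H by that of B, so the two row spaces coincide; since H
   and B are symmetric, B w = H q becomes solvable. *)
have HB : (H <= B)%MS.
  have sBH : (B <= H)%MS by rewrite submxMl.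
  have [_ <-] := mxrank_leqif_sup sBH; apply/eqP.
  have := mxrankS kerBH; rewrite !mxrank_ker.
  by have := rank_leq_row B; have := rank_leq_row H; have := mxrankS sBH; lia.
have /submxP[D HD] := HB.
have BT : B^T = B by rewrite /B !trmx_mul trmxK Hsym !mulmxA.
have [w Bw] : exists w, B *m w = H *m q.
  by exists (D^T *m q); rewrite mulmxA -[B]BT -trmx_mul -HD Hsym.
pose y := P *m (H *m w).
have HPy : H *m (P^T *m y) = H *m q by rewrite /y !mulmxA -/B Bw.
have yy : enorm y ^+ 2 = dot (H *m w) q.
  rewrite sqr_enorm {1}/y dot_mulmxl.
  by rewrite [LHS]dot_mulmxl [RHS]dot_mulmxl Hsym HPy.
(* |y|^2 = dot (H w) q <= |H w| |q|, while tau |H w| <= |y|. *)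
have ny : tau * enorm y <= enorm q.
  have [y00|y00] := eqVneq (enorm y) 0; first by rewrite y00 mulr0 enorm_ge0.
  have yp : 0 < enorm y by rewrite lt0r y00 enorm_ge0.
  rewrite -(ler_pM2r yp) -mulrA -expr2 yy.
  have := dot_le_enorm (H *m w) q => h1; have h2 := inj w; rewrite -/y in h2.
  have h3 := enorm_ge0 q; apply: (@le_trans _ _ (enorm q * (tau * enorm (H *m w)))).
    by rewrite mulrCA (ler_pM2l tau0) mulrC.
  by rewrite ler_wpM2l.
have := psd y; have -> : dot y (P *m H *m P^T *m y) = a * enorm q ^+ 2.
  by rewrite -!mulmxA HPy dotC !dot_mulmxl Hsym HPy Hq dotZr sqr_enorm.
have q2 : 0 < enorm q ^+ 2 by rewrite exprn_gt0 // enorm_gt0.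
have t2 : 0 < tau ^+ 2 by rewrite exprn_gt0.
move=> h; rewrite -mulNr ler_pdivrMr //.
have : tau ^+ 2 * enorm y ^+ 2 <= enorm q ^+ 2.
  by rewrite -exprMn ler_pXn2r ?nnegrE ?enorm_ge0 // mulr_ge0 ?enorm_ge0 ?ltW.
move=> h'; rewrite -(ler_pM2r q2).
have : - th * enorm q ^+ 2 <= - th * (tau ^+ 2 * enorm y ^+ 2).
  by rewrite ler_wnM2l // oppr_le0.
have : tau ^+ 2 * (- th * enorm y ^+ 2) <= tau ^+ 2 * (a * enorm q ^+ 2).
  by rewrite ler_pM2l.
lra.
Qed.

End Euclidean.

(** * Taylor bounds and symmetry of the Hessian *)

Section OperatorNorm.
Context {R : realType}.

(** The supremum in [opnorm] is only meaningful for a bounded set; Cauchy-Schwarz on each row bounds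
    it by the Frobenius norm. *)
Lemma enorm_mulmx_opnorm m n (A : 'M[R]_(m, n)) (v : 'cV[R]_n) :
  enorm (A *m v) <= opnorm A * enorm v.
Proof.
have has_sup_A : has_sup [set enorm (A *m v) | v in [set v : 'cV[R]_n | enorm v <= 1]].
  split; first by exists (enorm (A *m 0)), 0 => //=; rewrite enorm0.
  exists (Num.sqrt (\sum_i dot (row i A)^T (row i A)^T)) => _ [u /= u1 <-].
  rewrite enormE ler_sqrt; last by apply: sumr_ge0 => i _; exact: dot_ge0.
  apply: ler_sum => i _; have -> : (A *m u) i 0 = dot (row i A)^T u.
    by rewrite -dot_mx trmxK -row_mul [RHS]mxE.
  rewrite -expr2 -real_normK ?num_real // -sqr_enorm.
  rewrite ler_pXn2r ?nnegrE ?enorm_ge0 // (le_trans (cauchy_schwarz _ _)) //.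
  by rewrite ler_piMr ?enorm_ge0.
have [->|v0] := eqVneq v 0; first by rewrite mulmx0 !enorm0 mulr0.
have nv : 0 < enorm v by rewrite enorm_gt0.
rewrite -ler_pdivrMr // mulrC.
have : enorm (A *m ((enorm v)^-1 *: v)) <= opnorm A.
  apply: ub_le_sup; first by case: has_sup_A.
  exists ((enorm v)^-1 *: v) => //=.
  by rewrite enormZ normfV gtr0_norm // mulVf // gt_eqF.
by rewrite -scalemxAr enormZ normfV gtr0_norm.
Qed.

End OperatorNorm.

Section Calculus.
Context {R : realType} {n : nat}.
Implicit Types (x h u v : 'cV[R]_n).

Lemma derive_dir (g : 'cV[R]_n -> R) x h : differentiable g x ->
  'D_h g x = \sum_i h i 0 * 'D_(delta_mx i 0 : 'cV[R]_n) g x.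
Proof.
move=> dg; rewrite deriveE //.
have {1}-> : h = \sum_i h i 0 *: (delta_mx i 0 : 'cV[R]_n).
  rewrite {1}(matrix_sum_delta h); apply: eq_bigr => i _.
  by rewrite big_ord1.
rewrite linear_sum; apply: eq_bigr => i _.
by rewrite linearZ /= deriveE.
Qed.

Lemma is_derive_line (g : 'cV[R]_n -> R) x h (t : R) :
  differentiable g (x + t *: h) ->
  is_derive t (1 : R) (fun r : R => g (x + r *: h)) ('D_h g (x + t *: h)).
Proof.
move=> dg; have dv : derivable g (x + t *: h) h by exact: diff_derivable.
have E : (fun r : R => r^-1 *: (((fun r => g (x + r *: h)) \o shift t) (r *: 1)
            - g (x + t *: h))) =
         (fun r : R => r^-1 *: ((g \o shift (x + t *: h)) (r *: h)
            - g (x + t *: h))).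
  apply/funext => r /=; congr (_ *: (g _ - _)).
  by rewrite [r *: 1]mulr1 scalerDl addrCA addrA [r *: h + x]addrC -addrA
             [_ + t *: h]addrC addrA addrAC.
by split; rewrite /derivable /derive E.
Qed.

Lemma is_derive_mvt (g dg : R -> R) (a b : R) : a <= b ->
  (forall t, is_derive t (1 : R) g (dg t)) ->
  exists2 c, a <= c <= b & g b - g a = dg c * (b - a).
Proof.
move=> ab dgE; have [|c] := MVT_segment ab (fun t _ => dgE t).
  apply: continuous_subspaceT => t.
  exact/differentiable_continuous/derivable1_diffP.
by rewrite in_itv /= => cab ->; exists c.
Qed.

Lemma is_derive_le0 (g dg : R -> R) (a b : R) : a <= b ->
  (forall t, is_derive t (1 : R) g (dg t)) ->
  (forall t, a <= t <= b -> dg t <= 0) -> g b <= g a.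
Proof.
move=> ab dgE dg0; have [c /dg0 c0 E] := is_derive_mvt ab dgE.
by rewrite -subr_le0 E mulr_le0_ge0 // subr_ge0.
Qed.

Lemma le_of_le_addM (a b K : R) : 0 <= K ->
  (forall t, 0 < t -> a <= b + t * K) -> a <= b.
Proof.
move=> K0 H; apply/ler_addgt0Pr => e e0.
have K1 : 0 < K + 1 by rewrite ltr_wpDl.
rewrite (le_trans (H (e / (K + 1)) _)) ?divr_gt0 // lerD2l.
by rewrite mulrAC ler_pdivrMr // ler_pM2l // lerDl.
Qed.

Lemma enorm_addKB x h : enorm (x + h - x) = enorm h.
Proof. by rewrite addrAC subrr add0r. Qed.

Variables (f : 'cV[R]_n -> R) (M : R).
Hypotheses (fC2 : C2 f) (M0 : 0 <= M).
Hypothesis hess_lip :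
  forall y1 y2, opnorm (hess f y1 - hess f y2) <= M * enorm (y1 - y2).

Lemma is_derive_line_f x h t :
  is_derive t (1 : R) (fun r : R => f (x + r *: h)) (dot (grad f (x + t *: h)) h).
Proof.
have [df _ _] := fC2; apply: is_derive_eq (is_derive_line (df _)) _.
by rewrite derive_dir //; apply: eq_bigr => i _; rewrite mxE mulrC.
Qed.

Lemma is_derive_line_grad x h v t :
  is_derive t (1 : R) (fun r : R => dot (grad f (x + r *: h)) v)
    (dot (hess f (x + t *: h) *m h) v).
Proof.
have [_ dg _] := fC2.
have dgi i y : differentiable (fun y => grad f y i 0) y.
  by apply: (@differentiable_comp _ _ _ _ (grad f) (fun N : 'cV[R]_n => N i 0));
    [exact: dg|exact: differentiable_coord].
have -> : (fun r : R => dot (grad f (x + r *: h)) v) =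
    \sum_i (v i 0 *: (fun r : R => grad f (x + r *: h) i 0)).
  by apply/funext => r; rewrite fct_sumE; apply: eq_bigr => i _;
    rewrite mulrC.
apply: is_derive_eq.
  apply: (@is_derive_sum _ _ _ _ _ _ _
    (fun i => v i 0 *: 'D_h (fun y => grad f y i 0) (x + t *: h))) => i.
  exact: is_deriveZ (is_derive_line (dgi i _)).
apply: eq_bigr => i _; rewrite [LHS]mulrC; congr (_ * _).
by rewrite derive_dir // mxE; apply: eq_bigr => j _; rewrite mxE mulrC.
Qed.

Lemma hess_form_lip y1 y2 u v :
  `|dot (hess f y1 *m u) v - dot (hess f y2 *m u) v|
    <= M * enorm (y1 - y2) * enorm u * enorm v.
Proof.
rewrite -dotNl -dotDl -mulmxBl (le_trans (cauchy_schwarz _ _)) //.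
rewrite ler_wpM2r ?enorm_ge0 // (le_trans (enorm_mulmx_opnorm _ _)) //.
by rewrite ler_wpM2r ?enorm_ge0.
Qed.

Lemma grad_mvt x h v t : 0 <= t -> exists2 c, 0 <= c <= t &
  dot (grad f (x + t *: h) - grad f x) v
  = t * dot (hess f (x + c *: h) *m h) v.
Proof.
move=> t0; have [c ct] := is_derive_mvt t0 (is_derive_line_grad x h v).
by rewrite scale0r addr0 subr0 dotDl dotNl [X in _ = X -> _]mulrC; exists c.
Qed.

(* The second difference of f along t u and t v is t^2 times the Hessian form
   at a point within O(t) of x, in either order of u and v. *)
Lemma hess_second_difference x u v t : 0 < t -> exists2 a,
  `|a - dot (hess f x *m v) u| <= t * (M * (enorm u + enorm v) * enorm u * enorm v) &
  f (x + t *: u + t *: v) - f (x + t *: u) - (f (x + t *: v) - f x) = t ^+ 2 * a.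
Proof.
move=> t0; pose phi r := f (x + t *: v + r *: u) - f (x + r *: u).
have dphi r : is_derive r (1 : R) phi
    (dot (grad f (x + t *: v + r *: u)) u - dot (grad f (x + r *: u)) u).
  by apply: is_deriveB; exact: is_derive_line_f.
have [c /andP[c0 ct]] := is_derive_mvt (ltW t0) dphi.
rewrite /phi !scale0r !addr0 subr0 => E.
have [e /andP[e0 et] E2] := grad_mvt (x + c *: u) v u (ltW t0).
exists (dot (hess f (x + c *: u + e *: v) *m v) u).
  rewrite (le_trans (hess_form_lip _ _ _ _)) // !mulrA.
  rewrite -[_ * enorm v * enorm u]mulrA [enorm v * _]mulrC mulrA.
  rewrite !ler_wpM2r ?enorm_ge0 // [t * M]mulrC -mulrA ler_wpM2l //.
  rewrite addrAC [_ - x]addrAC subrr add0r (le_trans (enormD _ _)) //.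
  rewrite !enormZ !ger0_norm // mulrDr lerD // ler_wpM2r ?enorm_ge0 //.
rewrite [x + t *: u + t *: v]addrAC E -dotNl -dotDl.
by rewrite [x + t *: v + _]addrAC E2 mulrAC -expr2.
Qed.

(** Schwarz's theorem: the second difference is symmetric in its two directions, so both Hessian
    forms lie within O(t) of the same number, for every t > 0. *)
Lemma hess_sym x : (hess f x)^T = hess f x.
Proof.
suff H u v : dot (hess f x *m v) u <= dot (hess f x *m u) v.
  have {}H u v : dot (hess f x *m v) u = dot (hess f x *m u) v.
    by apply/eqP; rewrite eq_le !H.
  apply/matrixP => i j; rewrite mxE.
  have := H (delta_mx j 0) (delta_mx i 0).
  have E a b : dot (hess f x *m delta_mx a 0) (delta_mx b 0) = hess f x b a.
    rewrite /dot (bigD1 b) //= big1 ?addr0 => [|k kb]; last first.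
      by rewrite [X in _ * X]mxE (negbTE kb) mulr0.
    by rewrite -colE [X in _ * X]mxE !eqxx mulr1 mxE.
  by rewrite !E.
apply: (@le_of_le_addM _ _ (2 * (M * (enorm u + enorm v) * enorm u * enorm v))).
  by rewrite !mulr_ge0 ?addr_ge0 ?enorm_ge0.
move=> t t0.
have [a ha Ea] := hess_second_difference x u v t0.
have [b hb Eb] := hess_second_difference x v u t0.
have ab : a = b.
  apply: (@mulfI _ (t ^+ 2)); first by rewrite gt_eqF // exprn_gt0.
  by rewrite -Ea -Eb [x + t *: v + _]addrAC; ring.
have E : M * (enorm v + enorm u) * enorm v * enorm u =
  M * (enorm u + enorm v) * enorm u * enorm v by ring.
rewrite E -ab ler_norml in hb; rewrite ler_norml in ha.
by case/andP: ha => h1 _; case/andP: hb => _ h2; lra.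
Qed.

Lemma grad_increment x h v t : 0 <= t -> exists2 a,
  `|a - dot (hess f x *m h) v| <= t * (M * enorm h * enorm h * enorm v) &
  dot (grad f (x + t *: h) - grad f x) v = t * a.
Proof.
move=> t0; have [c /andP[c0 ct] E] := grad_mvt x h v t0.
exists (dot (hess f (x + c *: h) *m h) v) => //.
rewrite (le_trans (hess_form_lip _ _ _ _)) // enorm_addKB enormZ (ger0_norm c0).
rewrite !mulrA !ler_wpM2r ?enorm_ge0 //.
by rewrite [t * M]mulrC ler_wpM2l.
Qed.

Lemma hess_line_lip x h r : 0 <= r ->
  dot (hess f (x + r *: h) *m h) h - dot h (hess f x *m h) <= M * enorm h ^+ 3 * r.
Proof.
move=> r0; rewrite [X in _ - X]dotC.
apply: (le_trans (ler_norm _)); rewrite (le_trans (hess_form_lip _ _ _ _)) //.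
rewrite enorm_addKB enormZ (ger0_norm r0) le_eqVlt; apply/orP; left; apply/eqP.
by ring.
Qed.

(** The gradient increment along t h is tested against w = H h itself: divided by t, it is |w|^2 up
    to O(t), and the Lipschitz bound controls it. *)
Lemma enorm_hess_le L x h :
  (forall y1 y2, enorm (grad f y1 - grad f y2) <= L * enorm (y1 - y2)) ->
  enorm (hess f x *m h) <= L * enorm h.
Proof.
move=> lip; set w := hess f x *m h.
have [->|w0] := eqVneq w 0.
  by rewrite enorm0 (le_trans (enorm_ge0 _) (le_trans (lip (x + h) x) _)) // addrC addKr.
suff : dot w w <= L * enorm h * enorm w.
  by rewrite -sqr_enorm expr2 ler_pM2r // enorm_gt0.
apply: (@le_of_le_addM _ _ (M * enorm h * enorm h * enorm w)).
  by rewrite !mulr_ge0 ?enorm_ge0.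
move=> t t0; have [a ha E] := grad_increment x h w (ltW t0).
have b1 : a <= L * enorm h * enorm w.
  rewrite -(ler_pM2l t0) -E (le_trans (dot_le_enorm _ _)) //.
  have := lip (x + t *: h) x; rewrite enorm_addKB enormZ (gtr0_norm t0).
  move=> h1; rewrite !mulrA ler_wpM2r ?enorm_ge0 //.
  by rewrite [t * L]mulrC -mulrA.
move: ha; rewrite -[hess f x *m h]/w ler_norml => /andP[h1 _].
by lra.
Qed.

(** The Lipschitz bound on the Hessian along the line is integrated twice from 0; each integration
    is replaced by the monotonicity of a function with nonpositive derivative. The constants M/2 and
    M/6 are those of the successive primitives of M r. *)
Lemma cubic_upper_bound x h :
  f (x + h) <= f x + dot (grad f x) h + dot h (hess f x *m h) / 2
               + M / 6 * enorm h ^+ 3.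
Proof.
set g0 := dot (grad f x) h; set q := dot h _; set N := enorm h ^+ 3.
have N0 : 0 <= N by rewrite exprn_ge0 // enorm_ge0.
have dgr t : 0 <= t -> dot (grad f (x + t *: h)) h - g0 - q * t - M / 2 * N * t ^+ 2 <= 0.
  move=> t0.
  pose psi r := dot (grad f (x + r *: h)) h - g0 - q * r - M / 2 * N * r ^+ 2.
  have dpsi r : is_derive r (1 : R) psi
     (dot (hess f (x + r *: h) *m h) h - q - M * N * r).
    have D := is_derive_line_grad x h h r; rewrite /psi.
    by apply: is_derive_eq; rewrite /GRing.scale /=; lra.
  have : psi t <= psi 0.
    apply: is_derive_le0 t0 dpsi _ => r /andP[r0 _].
    by have := hess_line_lip x h r0; rewrite -/q -/N; lra.
  rewrite /psi scale0r addr0 -/g0 => h0; apply: (le_trans h0).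
  by rewrite le_eqVlt; apply/orP; left; apply/eqP; ring.
pose psi r := f (x + r *: h) - f x - g0 * r - q / 2 * r ^+ 2 - M / 6 * N * r ^+ 3.
have dpsi r : is_derive r (1 : R) psi
   (dot (grad f (x + r *: h)) h - g0 - q * r - M / 2 * N * r ^+ 2).
  have D := is_derive_line_f x h r; rewrite /psi.
  by apply: is_derive_eq; rewrite /GRing.scale /=; lra.
have : psi 1 <= psi 0.
  by apply: is_derive_le0 ler01 dpsi _ => r /andP[r0 _]; exact: dgr.
rewrite /psi scale0r scale1r addr0 !mulr0 !expr0n !expr1n /=.
by lra.
Qed.

End Calculus.

(** * Independence and Fubini *)

Section Independence.
Context {R : realType} {d : measure_display} {T : measurableType d}
  (Pr : probability T R).
Implicit Types (G : set (set T)) (A B : set T).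

Lemma g_sigma_sub_measurable G : G `<=` measurable -> <<s G >> `<=` measurable.
Proof. exact: (smallest_sub (@sigma_algebra_measurable _ T)). Qed.

(** Uniqueness of measures on a pi-system: restriction of [Pr] to B and [Pr] scaled by Pr B are
    finite measures that agree on [G]. *)
Lemma indep_left_g_sigma G B : G `<=` measurable -> setI_closed G ->
  G setT -> measurable B ->
  (forall A, G A -> Pr (A `&` B) = (Pr A * Pr B)%E) ->
  forall A, <<s G >> A -> Pr (A `&` B) = (Pr A * Pr B)%E.
Proof.
move=> Gm GI GT mB H A sA.
have PB0 : 0 <= fine (Pr B) by rewrite fine_ge0.
pose c : {nonneg R} := NngNum PB0.
have cE : c%:num%:E = Pr B by rewrite /= fineK // fin_num_measure.
have -> : (Pr A * Pr B = mscale c Pr A)%E by rewrite /mscale cE muleC.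
rewrite -[LHS]/(mrestr Pr mB A).
apply: (g_sigma_algebra_measure_unique G _ (fun=> setT)) => //.
- by rewrite bigcup_const //; exists 0%N.
- by move=> A' /H h; rewrite /= /mrestr /mscale cE muleC.
- by move=> _; rewrite /= /mrestr setTI (le_lt_trans (probability_le1 _ _)) // ltry.
Qed.

Lemma indep_g_sigma G1 G2 : G1 `<=` measurable -> G2 `<=` measurable ->
  setI_closed G1 -> setI_closed G2 -> G1 setT -> G2 setT ->
  (forall A B, G1 A -> G2 B -> Pr (A `&` B) = (Pr A * Pr B)%E) ->
  forall A B, <<s G1 >> A -> <<s G2 >> B -> Pr (A `&` B) = (Pr A * Pr B)%E.
Proof.
move=> m1 m2 I1 I2 T1 T2 H A B sA sB.
have mA := g_sigma_sub_measurable m1 sA.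
rewrite setIC muleC; apply: (indep_left_g_sigma m2) => // B' G2B'.
rewrite setIC muleC; apply: (indep_left_g_sigma m1) => //; first exact: m2.
by move=> A' G1A'; exact: H.
Qed.

Lemma measurable_id_g_sigma G : G `<=` measurable ->
  measurable_fun setT (id : T -> g_sigma_algebraType G).
Proof. by move=> Gm _ B mB; rewrite setTI; exact: (g_sigma_sub_measurable Gm). Qed.

End Independence.

Section IndependentPair.
Context {R : realType} {d : measure_display} {T : measurableType d}
  (Pr : probability T R).
Context {d1 d2 : measure_display} {T1 : measurableType d1} {T2 : measurableType d2}
  (X1 : {mfun T >-> T1}) (X2 : {mfun T >-> T2}).
Hypothesis indep12 : forall A B, measurable A -> measurable B ->
  Pr (X1 @^-1` A `&` X2 @^-1` B) = (Pr (X1 @^-1` A) * Pr (X2 @^-1` B))%E.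

Let X12_measurable : measurable_fun setT (fun w => (X1 w, X2 w)).
Proof. exact: measurable_fun_pair. Qed.

Let X12 : {mfun T >-> (T1 * T2)%type} :=
  HB.pack (fun w => (X1 w, X2 w)) (isMeasurableFun.Build _ _ _ _ _ X12_measurable).

(** Independence identifies the joint law with the product of the two laws on rectangles, hence
    everywhere by uniqueness of the product measure; Tonelli then applies. *)
Lemma indep_fubini (F : T1 * T2 -> \bar R) :
  measurable_fun [set: T1 * T2] F -> (forall u, 0 <= F u)%E ->
  (\int[Pr]_w F (X1 w, X2 w) = \int[Pr]_w1 \int[Pr]_w2 F (X1 w1, X2 w2))%E.
Proof.
move=> mF F0; pose P1 := distribution Pr X1; pose P2 := distribution Pr X2.
have E X : measurable X -> (P1 \x P2)%E X = distribution Pr X12 X.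
  by apply: product_measure_unique => A B mA mB; rewrite /P1 /P2 -indep12.
rewrite -(ge0_integral_distribution X12 mF F0).
rewrite -(@eq_measure_integral _ _ _ _ _ (P1 \x P2)%E); last by move=> A mA _; exact: E.
have FE w1 : (fubini_F P2 F w1 = \int[Pr]_w2 F (w1, X2 w2))%E.
  rewrite /fubini_F (ge0_integral_distribution X2 (f := fun w2 => F (w1, w2))) //.
  exact: measurable_fun_pair2.
rewrite fubini_tonelli1 // -(ge0_integral_distribution X1
  (f := fun w1 => (\int[Pr]_w2 F (w1, X2 w2))%E)).
- by apply: eq_integral => w1 _; exact: FE.
- by under eq_fun do rewrite -FE; exact: measurable_fun_fubini_tonelli_F.
- by move=> w1; apply: integral_ge0.
Qed.

(** Replaces a conditional probability given the first variable: that variable is frozen, and the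
    bound on the sections is integrated against its law. *)
Lemma indep_le_section (D : set (T1 * T2)) (p : \bar R) :
  measurable D -> (forall w1, Pr [set w2 | D (X1 w1, X2 w2)] <= p)%E ->
  (Pr [set w | D (X1 w, X2 w)] <= p)%E.
Proof.
move=> mD H; pose P1 := distribution Pr X1; pose P2 := distribution Pr X2.
have E X : measurable X -> (P1 \x P2)%E X = distribution Pr X12 X.
  by apply: product_measure_unique => A B mA mB; rewrite /P1 /P2 -indep12.
rewrite -[leLHS]/(distribution Pr X12 D) -E //.
rewrite [leLHS](ge0_integral_distribution X1); last 2 first.
- exact: measurable_fun_xsection.
- by move=> w1; exact: measure_ge0.
apply: (@le_trans _ _ (\int[Pr]_w1 p)%E); last first.
  by rewrite integral_cst //= probability_setT mule1.
apply: ge0_le_integral => //.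
- by apply: measurableT_comp => //; exact: measurable_fun_xsection.
- move=> w1 _; apply: le_trans (H w1); rewrite /= /P2 /distribution /pushforward.
  by rewrite le_eqVlt; apply/orP; left; apply/eqP; congr (Pr _);
    apply/seteqP; split => w2 /=; rewrite /xsection /= inE.
Qed.

End IndependentPair.

(** * Gaussian families *)

Section NormalLaplace.
Context {R : realType}.
Local Notation mu := (@lebesgue_measure R).

(** The Radon-Nikodym derivative and [normal_pdf] have the same integral over every measurable set,
    hence agree almost everywhere. *)
Lemma integral_normal_prob (m sigma : R) (g : R -> \bar R) :
  (normal_prob m sigma).-integrable setT g ->
  (\int[normal_prob m sigma]_x g x =
   \int[mu]_x (g x * (normal_pdf m sigma x)%:E))%E.
Proof.
move=> ig; have dom := @normal_prob_dominates R m sigma.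
rewrite -(Radon_Nikodym_change_of_variables dom measurableT ig).
have mg := measurable_int _ ig.
apply: ae_eq_integral => //.
- by apply: emeasurable_funM => //; apply: measurable_int (Radon_Nikodym_integrable _).
- apply: emeasurable_funM => //; apply/measurable_EFinP.
  exact: measurable_normal_pdf.
- apply: ae_eqe_mul2l; apply: integral_ae_eq => //.
  + exact: Radon_Nikodym_integrable.
  + by apply/measurable_EFinP; exact: measurable_normal_pdf.
  + by move=> E _ mE; rewrite -Radon_Nikodym_integral.
Qed.

(** Completing the square turns the integrand into a constant times the normal density with mean
    [m'] and standard deviation [s']. The constant is again an exponential of y^2, with lam/D for
    lam, which lets the coordinates be integrated out one after another. *)
Lemma normal_laplace (sigma lam y u : R) : 0 < sigma -> 0 <= lam ->
  let D := 1 + 2 * lam * sigma ^+ 2 * u ^+ 2 in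
  (\int[normal_prob 0 sigma]_x (expR (- (lam * (y + u * x) ^+ 2)))%:E
   = ((Num.sqrt D)^-1 * expR (- (lam / D * y ^+ 2)))%:E)%E.
Proof.
move=> s0 l0 D.
have D0 : 0 < D.
  by rewrite /D ltr_pwDl // mulr_ge0 ?sqr_ge0 // mulr_ge0 ?sqr_ge0 // mulr_ge0.
have sD0 : 0 < Num.sqrt D by rewrite sqrtr_gt0.
pose s' := sigma / Num.sqrt D.
have s'0 : 0 < s' by rewrite divr_gt0.
pose m' := - (2 * lam * sigma ^+ 2 * u * y / D).
have meas : measurable_fun setT (fun x : R => (expR (- (lam * (y + u * x) ^+ 2)))%:E).
  apply/measurable_EFinP; apply: measurableT_comp => //=.
  apply: measurable_funN; apply: measurable_funM => //.
  by apply: measurable_funX; apply: measurable_funD => //; apply: measurable_funM.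
rewrite integral_normal_prob; last first.
  apply/integrableP; split => //.
  apply: (@le_lt_trans _ _ (\int[normal_prob 0 sigma]_x (cst 1 x))%E).
    apply: ge0_le_integral => //.
    - exact: measurableT_comp.
    - move=> x _; rewrite gee0_abs ?lee_fin ?expR_ge0 //.
      by rewrite -expR0 ler_expR oppr_le0 mulr_ge0 // sqr_ge0.
  by rewrite integral_cst //= probability_setT mule1 ltry.
have E x : expR (- (lam * (y + u * x) ^+ 2)) * normal_pdf 0 sigma x =
    (Num.sqrt D)^-1 * expR (- (lam / D * y ^+ 2)) * normal_pdf m' s' x.
  rewrite !normal_pdfE ?gt_eqF // /normal_fun.
  have peakE : normal_peak sigma = (Num.sqrt D)^-1 * normal_peak s'.
    rewrite /normal_peak -invfM; congr (_^-1).
    rewrite -sqrtrM ?ltW //; congr Num.sqrt.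
    rewrite /s' expr_div_n sqr_sqrtr ?ltW // !mulr2n.
    by field; rewrite gt_eqF.
  rewrite peakE mulrCA -expRD -!mulrA; congr (_ * _).
  rewrite [RHS]mulrCA; congr (_ * _); rewrite -expRD; congr expR.
  rewrite /s' /m' expr_div_n sqr_sqrtr ?ltW // !mulr2n.
  by rewrite /D; field; rewrite -/D !gt_eqF // addr_gt0 // exprn_gt0.
transitivity (\int[mu]_x (((Num.sqrt D)^-1 * expR (- (lam / D * y ^+ 2)))%:E *
    (normal_pdf m' s' x)%:E))%E.
  by apply: eq_integral => x _; rewrite -!EFinM E.
rewrite ge0_integralZl //.
- by rewrite integral_normal_pdf mule1.
- by apply/measurable_EFinP; exact: measurable_normal_pdf.
- by move=> x _; rewrite lee_fin normal_pdf_ge0.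
Qed.

End NormalLaplace.

Section FamilySigmaAlgebra.
Context {R : realType} {d : measure_display} {T : measurableType d}
  (Pr : probability T R) {I : finType} (X : I -> T -> R).
Hypothesis X_measurable : forall i, measurable_fun setT (X i).

(** Measurability of a function for the sigma-algebra generated by this set expresses that it
    depends only on the coordinates in [J]. *)
Definition family_gen (J : pred I) : set (set T) :=
  [set A | exists2 i, J i & exists2 B : set R, measurable B & A = X i @^-1` B].

(** Unlike [family_gen], the rectangles are stable under intersection, as uniqueness on a pi-system
    requires. *)
Let rect (J : pred I) : set (set T) :=
  [set A | exists Bs : I -> set R, [/\ forall i, measurable (Bs i),
    forall i, ~~ J i -> Bs i = setT & A = [set w | forall i, Bs i (X i w)]]].

Let X_preimage i (B : set R) : measurable B -> measurable (X i @^-1` B).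
Proof. by move=> mB; have := X_measurable i measurableT mB; rewrite setTI. Qed.

Lemma family_gen_measurable (J : pred I) : family_gen J `<=` measurable.
Proof. by move=> _ [i _ [B mB ->]]; exact: X_preimage. Qed.

Lemma family_gen_fun (J : pred I) i : J i ->
  measurable_fun setT (X i : g_sigma_algebraType (family_gen J) -> R).
Proof.
by move=> Ji _ B mB; rewrite setTI; apply: sub_sigma_algebra; exists i => //; exists B.
Qed.

Lemma family_gen_mono (J1 J2 : pred I) (g : T -> R) : subpred J1 J2 ->
  measurable_fun setT (g : g_sigma_algebraType (family_gen J1) -> R) ->
  measurable_fun setT (g : g_sigma_algebraType (family_gen J2) -> R).
Proof.
move=> J12 mg _ B mB; have := mg measurableT B mB; rewrite setTI.
apply: smallest_sub; first exact: smallest_sigma_algebra.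
by move=> _ [i Ji [C mC ->]]; apply: sub_sigma_algebra; exists i; [exact: J12|exists C].
Qed.

Lemma family_gen_measurable_fun (J : pred I) (g : T -> R) :
  measurable_fun setT (g : g_sigma_algebraType (family_gen J) -> R) ->
  measurable_fun setT g.
Proof.
move=> mg _ B mB; have := mg measurableT B mB; rewrite setTI.
exact: (g_sigma_sub_measurable (@family_gen_measurable J)).
Qed.

Hypothesis X_indep : forall B : I -> set R, (forall i, measurable (B i)) ->
  Pr [set w | forall i, B i (X i w)] = (\prod_i Pr (X i @^-1` B i))%E.

(** The product formula is given for rectangles in all coordinates at once. Two rectangles over
    disjoint index sets intersect in such a rectangle, and at each coordinate at least one of the
    two sides is [setT], so the product splits. *)
Lemma family_indep (J1 J2 : pred I) : (forall i, J1 i -> ~~ J2 i) ->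
  forall A B, <<s family_gen J1 >> A -> <<s family_gen J2 >> B ->
  Pr (A `&` B) = (Pr A * Pr B)%E.
Proof.
move=> J12 A B sA sB.
have rectm J : rect J `<=` measurable.
  move=> _ [Bs [mBs _ ->]].
  rewrite (_ : [set w | _] = \bigcap_(i in [set: I]) (X i @^-1` Bs i)).
    by apply: fin_bigcap_measurable => // i _; exact: X_preimage.
  by apply/seteqP; split => w /= h i; [move=> _; exact: h|exact: (h i Logic.I)].
have rectI J : setI_closed (rect J).
  move=> _ _ [B1 [m1 T1 ->]] [B2 [m2 T2 ->]].
  exists (fun i => B1 i `&` B2 i); split.
  - by move=> i; exact: measurableI.
  - by move=> i Ji; rewrite T1 // T2 // setTI.
  - by apply/seteqP; split => w /=; [move=> [h1 h2] i; split|move=> h; split => i; case: (h i)].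
have rectT J : rect J setT.
  by exists (fun=> setT); split => //; apply/seteqP; split.
have genrect J : <<s family_gen J >> `<=` <<s rect J >>.
  apply: smallest_sub; first exact: smallest_sigma_algebra.
  move=> _ [i Ji [C mC ->]]; apply: sub_sigma_algebra.
  exists (fun j => if j == i then C else setT); split.
  - by move=> j; case: ifP.
  - by move=> j; case: eqP => // ->; rewrite Ji.
  - apply/seteqP; split => w /=; first by move=> Cw j; case: eqP => // ->.
    by move=> /(_ i); rewrite eqxx.
apply: (@indep_g_sigma _ _ _ Pr (rect J1) (rect J2)) => //; try exact: genrect.
move=> _ _ [B1 [m1 T1 ->]] [B2 [m2 T2 ->]].
have -> : [set w | forall i, B1 i (X i w)] `&` [set w | forall i, B2 i (X i w)]
   = [set w | forall i, (B1 i `&` B2 i) (X i w)].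
  by apply/seteqP; split => w /=; [move=> [h1 h2] i; split|move=> h; split => i; case: (h i)].
rewrite (X_indep m1) (X_indep m2) (X_indep (B := fun i => B1 i `&` B2 i)) => [|i];
  last exact: measurableI.
rewrite -big_split /=; apply: eq_bigr => i _.
have [J1i|J1i] := boolP (J1 i).
  by rewrite (T2 i (J12 _ J1i)) setIT preimage_setT probability_setT mule1.
by rewrite (T1 i J1i) setTI preimage_setT probability_setT mul1e.
Qed.

End FamilySigmaAlgebra.

Section GaussianElimination.
Context {R : realType} {d : measure_display} {T : measurableType d}
  (Pr : probability T R) {I : finType} (X : I -> T -> R) (sigma : R).
Hypothesis sigma0 : 0 < sigma.
Hypothesis X_measurable : forall i, measurable_fun setT (X i).
Hypothesis X_normal : forall i (B : set R), measurable B ->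
  Pr (X i @^-1` B) = normal_prob 0 sigma B.
Hypothesis X_indep : forall B : I -> set R, (forall i, measurable (B i)) ->
  Pr [set w | forall i, B i (X i w)] = (\prod_i Pr (X i @^-1` B i))%E.
Local Notation fam_alg J := (g_sigma_algebraType (family_gen X J)).

Lemma integral_gaussian_coordinate (lam y u : R) i : 0 <= lam ->
  let D := 1 + 2 * lam * sigma ^+ 2 * u ^+ 2 in
  (\int[Pr]_w (expR (- (lam * (y + u * X i w) ^+ 2)))%:E
   = ((Num.sqrt D)^-1 * expR (- (lam / D * y ^+ 2)))%:E)%E.
Proof.
move=> l0 D; rewrite -normal_laplace //.
have mXi : measurable_fun setT (X i : T -> measurableTypeR R) by exact: X_measurable.
pose Xi : {mfun T >-> measurableTypeR R} :=
  HB.pack (X i : T -> measurableTypeR R) (isMeasurableFun.Build _ _ _ _ _ mXi).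
rewrite -(ge0_integral_distribution Xi
  (f := fun x => (expR (- (lam * (y + u * x) ^+ 2)))%:E)).
- by apply: eq_measure_integral => A mA _; exact: X_normal.
- apply/measurable_EFinP; apply: measurableT_comp => //=.
  apply: measurable_funN; apply: measurable_funM => //.
  by apply: measurable_funX; apply: measurable_funD => //; apply: measurable_funM.
- by move=> x; rewrite lee_fin expR_ge0.
Qed.

(** [g] and [Y] depend on the coordinates in [J], of which coordinate [e] is independent: Fubini
    freezes the former, and the one-dimensional formula integrates out the latter. *)
Lemma integral_gaussian_eliminate (J : pred I) (g Y : T -> R) (lam u : R) e :
  ~~ J e -> 0 <= lam -> (forall w, 0 <= g w) ->
  measurable_fun setT (g : fam_alg J -> R) ->
  measurable_fun setT (Y : fam_alg J -> R) ->
  let D := 1 + 2 * lam * sigma ^+ 2 * u ^+ 2 in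
  (\int[Pr]_w (g w * expR (- (lam * (Y w + u * X e w) ^+ 2)))%:E
   = ((Num.sqrt D)^-1)%:E * \int[Pr]_w (g w * expR (- (lam / D * Y w ^+ 2)))%:E)%E.
Proof.
move=> Je l0 g0 mg mY D.
have mJ := family_gen_measurable X_measurable (J := J).
have me := family_gen_measurable X_measurable (J := pred1 e).
have i1 := measurable_id_g_sigma mJ; have i2 := measurable_id_g_sigma me.
(* Both variables are the identity of [T]; they differ in the sigma-algebra put on the target. *)
pose X1 : {mfun T >-> fam_alg J} :=
  HB.pack (id : T -> fam_alg J) (isMeasurableFun.Build _ _ _ _ _ i1).
pose X2 : {mfun T >-> fam_alg (pred1 e)} :=
  HB.pack (id : T -> fam_alg (pred1 e)) (isMeasurableFun.Build _ _ _ _ _ i2).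
have mXe : measurable_fun setT (X e : fam_alg (pred1 e) -> R).
  by apply: family_gen_fun => /=.
pose F (p : fam_alg J * fam_alg (pred1 e)) : \bar R :=
  (g p.1 * expR (- (lam * (Y p.1 + u * X e p.2) ^+ 2)))%:E.
have mF : measurable_fun setT F.
  apply/measurable_EFinP; apply: measurable_funM.
    exact: (measurableT_comp mg measurable_fst).
  apply: measurableT_comp => //=.
  apply: measurable_funN; apply: measurable_funM => //.
  apply: measurable_funX; apply: measurable_funD.
    exact: (measurableT_comp mY measurable_fst).
  by apply: measurable_funM => //; exact: (measurableT_comp mXe measurable_snd).
have F0 p : (0 <= F p)%E by rewrite lee_fin mulr_ge0 // expR_ge0.
have ind : forall A B, measurable A -> measurable B ->
    Pr (X1 @^-1` A `&` X2 @^-1` B) = (Pr (X1 @^-1` A) * Pr (X2 @^-1` B))%E.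
  move=> A B; apply: (family_indep X_measurable X_indep) => i Ji /=.
  by apply/eqP => ie; move: Je; rewrite -ie Ji.
rewrite (indep_fubini ind mF F0) -ge0_integralZl //.
- apply: eq_integral => w _; rewrite /F /=.
  under eq_integral do rewrite EFinM.
  rewrite ge0_integralZl ?lee_fin //.
  + by rewrite integral_gaussian_coordinate // -!EFinM; congr EFin; rewrite -/D; ring.
  + apply/measurable_EFinP; apply: measurableT_comp => //=.
    apply: measurable_funN; apply: measurable_funM => //.
    by apply: measurable_funX; apply: measurable_funD => //; apply: measurable_funM => //; exact: X_measurable.
- have mgT := family_gen_measurable_fun X_measurable mg.
  have mYT := family_gen_measurable_fun X_measurable mY.
  apply/measurable_EFinP; apply: measurable_funM => //.
  apply: measurableT_comp => //=.
  by apply: measurable_funN; apply: measurable_funM => //; exact: measurable_funX.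
- by move=> w _; rewrite lee_fin mulr_ge0 // expR_ge0.
Qed.

End GaussianElimination.

Section GaussianMatrix.
Context {R : realType} {d : measure_display} {T : measurableType d}
  (Pr : probability T R) {s n : nat} (P : T -> 'M[R]_(s, n)).
Hypotheses (s0 : (0 < s)%N) (Pg : gaussian_mx Pr P).
Let X (p : 'I_s * 'I_n) (w : T) : R := P w p.1 p.2.
Let sigma : R := Num.sqrt (s%:R^-1).
Local Notation fam_alg J := (g_sigma_algebraType (family_gen X J)).

Let sigma0 : 0 < sigma.
Proof. by rewrite sqrtr_gt0 invr_gt0 ltr0n. Qed.

Let sigma2 : sigma ^+ 2 = s%:R^-1.
Proof. by rewrite sqr_sqrtr // invr_ge0. Qed.

Let X_measurable p : measurable_fun setT (X p).
Proof. by case: Pg => h _ _; exact: h. Qed.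

Let X_normal p (B : set R) : measurable B -> Pr (X p @^-1` B) = normal_prob 0 sigma B.
Proof. by case: Pg => _ h _; exact: h. Qed.

Let X_indep (B : 'I_s * 'I_n -> set R) : (forall p, measurable (B p)) ->
  Pr [set w | forall p, B p (X p w)] = (\prod_p Pr (X p @^-1` B p))%E.
Proof.
move=> mB; case: Pg => _ _ h.
transitivity (\prod_i \prod_j Pr (X (i, j) @^-1` B (i, j)))%E; last first.
  by rewrite pair_bigA; apply: eq_bigr => -[].
rewrite -(h (fun i j => B (i, j))) //; congr (Pr _).
by apply/seteqP; split => w /=; [move=> H i j; exact: (H (i, j))|move=> H [i j]; exact: H].
Qed.

Variable u : 'cV[R]_n.

(** Induction on the number of columns, with [lam] universally quantified because each elimination
    replaces it by lam/D. The factors telescope: D (1 + 2 (lam/D) sigma^2 S) = D + 2 lam sigma^2 S.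
    The weight [g] leaves room for other rows. *)
Lemma gaussian_row_laplace (J : pred ('I_s * 'I_n)) (i : 'I_s) (g : T -> R) m lam :
  (m <= n)%N -> (forall j, ~~ J (i, j)) -> 0 <= lam -> (forall w, 0 <= g w) ->
  measurable_fun setT (g : fam_alg J -> R) ->
  (\int[Pr]_w (g w * expR (- (lam * (\sum_(j < n | (j < m)%N) u j 0 * P w i j) ^+ 2)))%:E
   = ((Num.sqrt (1 + 2 * lam * sigma ^+ 2 * (\sum_(j < n | (j < m)%N) u j 0 ^+ 2)))^-1)%:E
     * \int[Pr]_w (g w)%:E)%E.
Proof.
move=> + HJ + g0 mg; elim: m lam => [|m IH] lam mn l0.
  rewrite [in RHS]big_pred0 // mulr0 addr0 sqrtr1 invr1 mul1e.
  by apply: eq_integral => w _; rewrite big_pred0 // expr0n mulr0 oppr0 expR0 mulr1.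
pose jm : 'I_n := Ordinal mn.
have split_sum (F : 'I_n -> R) :
    \sum_(j < n | (j < m.+1)%N) F j = \sum_(j < n | (j < m)%N) F j + F jm.
  rewrite (bigD1 jm) //= addrC; congr (_ + _); apply: eq_bigl => j.
  by rewrite ltnS [RHS]ltn_neqAle andbC -val_eqE.
pose J' : pred ('I_s * 'I_n) := fun p => J p || ((p.1 == i) && (p.2 < m)%N).
have sJ : subpred J J' by move=> p; rewrite /J' => ->.
have J'e : ~~ J' (i, jm) by rewrite /J' negb_or HJ /= eqxx ltnn.
pose Y w := \sum_(j < n | (j < m)%N) u j 0 * P w i j.
have mY : measurable_fun setT (Y : fam_alg J' -> R).
  have -> : Y = fun w => \sum_(j < n) (if (j < m)%N then u j 0 * P w i j else 0).
    by apply/funext => w; rewrite /Y big_mkcond.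
  apply: measurable_sum => j; case: (boolP (j < m)%N) => jm' //.
  apply: measurable_funM => //.
  by apply: (family_gen_fun (X := X) (i := (i, j))); rewrite /J' /= eqxx jm' orbT.
under eq_integral do rewrite split_sum.
rewrite (integral_gaussian_eliminate sigma0 X_measurable X_normal X_indep
  (J := J') (g := g) (Y := Y) (u jm 0) J'e) //; last exact: family_gen_mono mg.
set D := 1 + _.
have D0 : 0 < D by rewrite ltr_pwDl // mulr_ge0 ?sqr_ge0 // mulr_ge0 ?sqr_ge0 // mulr_ge0.
rewrite /Y IH ?(ltnW mn) // ?divr_ge0 // ?(ltW D0) // muleA -EFinM.
congr (_%:E * _)%E; rewrite -invfM -sqrtrM ?(ltW D0) // split_sum.
set S := \sum_(j < n | _) _; congr (Num.sqrt _)^-1.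
have -> : D * (1 + 2 * (lam / D) * sigma ^+ 2 * S) = D + 2 * lam * sigma ^+ 2 * S.
  by field; rewrite gt_eqF.
by rewrite /D; ring.
Qed.

(** The Laplace transform of a scaled chi-square variable with s degrees of freedom, obtained row by
    row with the preceding rows as weight. *)
Lemma gaussian_laplace lam : 0 <= lam ->
  (\int[Pr]_w (expR (- (lam * enorm (P w *m u) ^+ 2)))%:E
   = (((Num.sqrt (1 + 2 * lam / s%:R * enorm u ^+ 2))^-1) ^+ s)%:E)%E.
Proof.
move=> l0; set c := (Num.sqrt _)^-1.
pose rowi (i : 'I_s) w := \sum_j u j 0 * P w i j.
pose g k w := expR (- (lam * \sum_(i < s | (i < k)%N) rowi i w ^+ 2)).
suff H k : (k <= s)%N -> (\int[Pr]_w (g k w)%:E = (c ^+ k)%:E)%E.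
  have <- := H s (leqnn s); apply: eq_integral => w _; congr (expR (- (_ * _)))%:E.
  rewrite sqr_enorm /dot; apply: eq_big => [i|i _]; first by rewrite ltn_ord.
  by rewrite -expr2 mxE; congr (_ ^+ 2); apply: eq_bigr => j _; rewrite mulrC.
elim: k => [_|k IH ks].
  rewrite expr0 /g; under eq_integral do rewrite big_pred0 // mulr0 oppr0 expR0.
  by rewrite integral_cst //= probability_setT mule1.
pose ik : 'I_s := Ordinal ks.
pose J : pred ('I_s * 'I_n) := fun p => (p.1 < k)%N.
have mg : measurable_fun setT (g k : fam_alg J -> R).
  apply: measurableT_comp => //=; apply: measurable_funN; apply: measurable_funM => //.
  have -> : (fun w => \sum_(i < s | (i < k)%N) rowi i w ^+ 2) =
     fun w => \sum_(i < s) (if (i < k)%N then rowi i w ^+ 2 else 0).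
    by apply/funext => w; rewrite big_mkcond.
  apply: measurable_sum => i; case: (boolP (i < k)%N) => ik' //; apply: measurable_funX.
  apply: measurable_sum => j; apply: measurable_funM => //.
  exact: (family_gen_fun (X := X) (i := (i, j))).
have := @gaussian_row_laplace J ik (g k) n lam (leqnn _) _ l0 _ mg.
rewrite IH ?(ltnW ks) // => E.
have -> : (c ^+ k.+1)%:E = (c%:E * (c ^+ k)%:E)%E by rewrite exprS EFinM.
have cE : c = (Num.sqrt (1 + 2 * lam * sigma ^+ 2 * (\sum_(j < n | (j < n)%N) u j 0 ^+ 2)))^-1.
  rewrite /c sigma2 sqr_enorm; congr (Num.sqrt (1 + _ * _))^-1.
  by apply: eq_big => [j|j _]; rewrite ?ltn_ord ?expr2.
rewrite {1}cE -E => [|j|w]; rewrite /J /= ?ltnn ?expR_ge0 //.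
apply: eq_integral => w _; rewrite /g -expRD -opprD -mulrDr.
congr (expR (- (_ * _)))%:E; rewrite (bigD1 ik) //= addrC; congr (_ + _).
  by apply: eq_bigl => i; rewrite ltnS [RHS]ltn_neqAle andbC -val_eqE.
by congr (_ ^+ 2); apply: eq_bigl => j; rewrite ltn_ord.
Qed.

End GaussianMatrix.

(** * Small ball estimates *)

Section SmallBall.
Context {R : realType} {d : measure_display} {T : measurableType d}
  (Pr : probability T R).

Lemma prob_finite_union_le {I : finType} (Q : pred I) (F : I -> set T) (p : R) :
  (forall i, Q i -> measurable (F i)) -> (forall i, Q i -> (Pr (F i) <= p%:E)%E) ->
  measurable (\bigcup_(i in [set` Q]) F i) /\
  (Pr (\bigcup_(i in [set` Q]) F i) <= (#|Q|%:R * p)%:E)%E.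
Proof.
move=> mF pF; rewrite bigcup_pred mulr_natl -sumr_const.
elim/big_ind2: _ => [|A a B b [mA pA] [mB pB]|i Qi]; last by split; [exact: mF|exact: pF].
  by rewrite measure0; split.
split; first exact: measurableU.
by rewrite (le_trans (measureU2 _ _ _)) // EFinD leeD.
Qed.

Lemma enorm_measurable {d' : measure_display} {T' : measurableType d'} m
    (v : T' -> 'cV[R]_m) :
  (forall i, measurable_fun setT (fun w => v w i 0)) ->
  measurable_fun setT (fun w => enorm (v w)).
Proof.
move=> mv; apply: (@measurableT_comp _ _ _ _ _ _ (@Num.sqrt R)).
  by apply: continuous_measurable_fun; exact: sqrt_continuous.
by apply: measurable_sum => i; apply: measurable_funX.
Qed.

Lemma prob_le_integral_div (A : set T) (F : T -> R) (c b : R) :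
  measurable A -> measurable_fun setT F -> (forall w, 0 <= F w) -> 0 < c ->
  (forall w, A w -> c <= F w) -> (\int[Pr]_w (F w)%:E <= b%:E)%E ->
  (Pr A <= (b / c)%:E)%E.
Proof.
move=> mA mF F0 c0 cF Fb.
have : (c%:E * Pr A <= b%:E)%E.
  apply: (le_trans _ Fb); rewrite -[A in Pr A]setIT -integral_indic // -ge0_integralZl //.
  - apply: ge0_le_integral => //.
    + by move=> w _; rewrite -EFinM lee_fin mulr_ge0 // ltW.
    + apply/measurable_EFinP; apply: measurable_funM => //; exact: measurable_indic.
    + exact/measurable_EFinP.
    + move=> w _; rewrite -EFinM lee_fin indicE.
      by case: (boolP (w \in A)) => [/set_mem/cF|_]; rewrite ?mulr1 ?mulr0.
  - by apply/measurable_EFinP; exact: measurable_indic.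
  - by rewrite lee_fin ltW.
have [p ->] : exists p, Pr A = p%:E.
  by exists (fine (Pr A)); rewrite fineK // fin_num_measure.
by rewrite -EFinM !lee_fin ler_pdivlMr // mulrC.
Qed.

Context {s n : nat} (P : T -> 'M[R]_(s, n)).
Hypotheses (s0 : (0 < s)%N) (Pg : gaussian_mx Pr P).

Lemma gaussian_enorm_measurable (u : 'cV[R]_n) :
  measurable_fun setT (fun w => enorm (P w *m u)).
Proof.
apply: enorm_measurable => i; under eq_fun do rewrite mxE.
by apply: measurable_sum => j; apply: measurable_funM => //; case: Pg.
Qed.

Lemma gaussian_le_measurable (u : 'cV[R]_n) (b : R) :
  measurable [set w | enorm (P w *m u) <= b].
Proof.
rewrite (_ : [set w | _] = (fun w => enorm (P w *m u)) @^-1` [set` `]-oo, b]]).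
  by rewrite -[X in measurable X]setTI; exact: gaussian_enorm_measurable.
by apply/seteqP; split => w /=; rewrite in_itv.
Qed.

Lemma gaussian_ge_measurable (u : 'cV[R]_n) (b : R) :
  measurable [set w | b <= enorm (P w *m u)].
Proof.
rewrite (_ : [set w | _] = (fun w => enorm (P w *m u)) @^-1` [set` `[b, +oo[]).
  by rewrite -[X in measurable X]setTI; exact: gaussian_enorm_measurable.
by apply/seteqP; split => w /=; rewrite in_itv /= andbT.
Qed.

Let laplace_measurable (u : 'cV[R]_n) (lam : R) :
  measurable_fun setT (fun w => expR (- (lam * enorm (P w *m u) ^+ 2))).
Proof.
apply: measurableT_comp => //=; apply: measurable_funN; apply: measurable_funM => //.
by apply: measurable_funX; exact: gaussian_enorm_measurable.
Qed.

Let sR0 : 0 < s%:R :> R. Proof. by rewrite ltr0n. Qed.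

(** Markov's inequality for exp(-lam |P u|^2), with [lam] chosen so that the exponent at the
    threshold is -s/2. The expectation is (1 + al^(-2))^(-s/2) <= al^s, and exp(-s/2) >= 2^(-s)
    accounts for the factor 2. *)
Lemma gaussian_small_ball (u : 'cV[R]_n) (al : R) : u != 0 -> 0 < al ->
  (Pr [set w | (enorm (P w *m u) <= al * enorm u)%R] <= ((2 * al) ^+ s)%:E)%E.
Proof.
move=> u0 al0; have nu : 0 < enorm u by rewrite enorm_gt0.
pose lam : R := s%:R / (2 * al ^+ 2 * enorm u ^+ 2).
have d0 : 0 < 2 * al ^+ 2 * enorm u ^+ 2 by rewrite !mulr_gt0 ?exprn_gt0.
have lam0 : 0 <= lam by rewrite divr_ge0 ?ltW.
have := gaussian_laplace s0 Pg u lam0.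
have -> : 1 + 2 * lam / s%:R * enorm u ^+ 2 = 1 + (al ^+ 2)^-1.
  by congr (1 + _); rewrite /lam; field; rewrite !gt_eqF.
move=> E.
have e2 : (2^-1 : R) <= expR (- 2^-1) by have := @expR_ge1Dx R (- 2^-1); lra.
have -> : (2 * al) ^+ s = al ^+ s / (2^-1) ^+ s by rewrite exprMn exprVn invrK mulrC.
apply: (@prob_le_integral_div _ (fun w => expR (- (lam * enorm (P w *m u) ^+ 2)))) => //.
- exact: gaussian_le_measurable.
- move=> w /= Aw; apply: (@le_trans _ _ (expR (- 2^-1) ^+ s)).
    by rewrite lerXn2r ?nnegrE ?invr_ge0 ?expR_ge0.
  rewrite -expRM_natl ler_expR mulrN lerN2 /lam mulrAC.
  rewrite ler_pdivrMr // (_ : s%:R * 2^-1 * (2 * al ^+ 2 * enorm u ^+ 2)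
    = s%:R * (al * enorm u) ^+ 2); last by field.
  by rewrite ler_pM2l // lerXn2r ?nnegrE ?enorm_ge0 // mulr_ge0 // ltW.
- have al0' := ltW al0; rewrite E lee_fin lerXn2r ?nnegrE ?invr_ge0 ?sqrtr_ge0 //.
  rewrite [leRHS](_ : al = (Num.sqrt ((al ^+ 2)^-1))^-1); last first.
    by rewrite -exprVn sqrtr_sqr ger0_norm ?invr_ge0 ?ltW // invrK.
  have i0 : 0 < (al ^+ 2)^-1 by rewrite invr_gt0 exprn_gt0.
  by rewrite lef_pV2 ?posrE ?sqrtr_gt0 ?addr_gt0 // ler_wsqrtr // lerDr.
Qed.

(** A second-moment type tail drawn from the Laplace transform: with lam = 1 / (r |u|)^2 the
    expectation is at least 1 - 1/r^2, and it is at most 1 - Pr A / 2 because the integrand is at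
    most 1/e <= 1/2 on [A]. *)
Lemma gaussian_large_ball (u : 'cV[R]_n) (r : R) : u != 0 -> 0 < r ->
  (Pr [set w | (r * enorm u <= enorm (P w *m u))%R] <= (2 / r ^+ 2)%:E)%E.
Proof.
move=> u0 r0; have nu : 0 < enorm u by rewrite enorm_gt0.
set A := [set w | _]; have mA : measurable A by exact: gaussian_ge_measurable.
pose lam : R := (r ^+ 2 * enorm u ^+ 2)^-1.
have d0 : 0 < r ^+ 2 * enorm u ^+ 2 by rewrite mulr_gt0 ?exprn_gt0.
have lam0 : 0 <= lam by rewrite invr_ge0 ltW.
pose x : R := 2 / (s%:R * r ^+ 2).
have x0 : 0 < x by rewrite divr_gt0 // mulr_gt0 // exprn_gt0.
have := gaussian_laplace s0 Pg u lam0.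
have -> : 1 + 2 * lam / s%:R * enorm u ^+ 2 = 1 + x.
  by congr (1 + _); rewrite /lam /x; field; rewrite !gt_eqF.
move=> E.
have lowE : 1 - (r ^+ 2)^-1 <= (Num.sqrt (1 + x))^-1 ^+ s.
  apply: (@le_trans _ _ (expR (- (r ^+ 2)^-1))); first exact: expR_ge1Dx.
  have -> : - (r ^+ 2)^-1 = s%:R * (- (x / 2)).
    by rewrite /x; field; rewrite !gt_eqF.
  rewrite expRM_natl lerXn2r ?nnegrE ?expR_ge0 ?invr_ge0 ?sqrtr_ge0 //.
  rewrite expRN lef_pV2 ?posrE ?expR_gt0 ?sqrtr_gt0 ?addr_gt0 //.
  rewrite -[leRHS]ger0_norm ?expR_ge0 // -sqrtr_sqr ler_wsqrtr //.
  by rewrite -expRM_natl mulrC divfK ?expR_ge1Dx // pnatr_eq0.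
have e1 : expR (- 1) <= 2^-1 :> R.
  rewrite expRN lef_pV2 ?posrE ?expR_gt0 //.
  by have := @expR_ge1Dx R 1; lra.
have up : (\int[Pr]_w (expR (- (lam * enorm (P w *m u) ^+ 2)))%:E
    <= Pr (~` A) + 2^-1%:E * Pr A)%E.
  have mA' : measurable (~` A) by exact: measurableC.
  have I B : measurable B -> Pr B = (\int[Pr]_w (\1_B w)%:E)%E.
    by move=> mB; rewrite integral_indic // setIT.
  have mI B : measurable B -> measurable_fun setT (EFin \o (\1_B : T -> R)).
    by move=> mB; apply/measurable_EFinP; exact: measurable_indic.
  have mh : measurable_fun setT (fun w => (2^-1 : R)%:E * (\1_A w : R)%:E)%E.
    by apply: emeasurable_funM => //; exact: mI.
  have mc : measurable_fun setT (fun w => (\1_(~` A) w : R)%:E) by exact: mI.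
  rewrite (I _ mA) (I _ mA') -ge0_integralZl ?lee_fin //; last exact: mI.
  rewrite -ge0_integralD //.
  - apply: ge0_le_integral => //.
    + apply/measurable_EFinP; exact: laplace_measurable.
    + exact: emeasurable_funD.
    + move=> w _; rewrite /= !indicE in_setC; case: (boolP (w \in A)) => [/set_mem Aw|_] /=.
        rewrite add0e mule1 lee_fin (le_trans _ e1) // ler_expR lerN2.
        rewrite -ler_pdivrMl ?invr_gt0 // invrK mulr1 -exprMn.
        by rewrite lerXn2r ?nnegrE ?enorm_ge0 // mulr_ge0 // ltW.
      by rewrite mule0 adde0 lee_fin -expR0 ler_expR oppr_le0 mulr_ge0 // sqr_ge0.
have [p pE] : exists p, Pr A = p%:E.
  by exists (fine (Pr A)); rewrite fineK // fin_num_measure.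
move: up; rewrite E probability_setC // pE -EFinM -EFinB -EFinD !lee_fin => up.
by rewrite -[2 / _]/(2 * _); lra.
Qed.

End SmallBall.

(** * Nets in an orthonormal frame *)

Section Orthonormal.
Context {R : realType}.

Lemma enorm_orthonormal n p (V : 'M[R]_(n, p)) (a : 'cV[R]_p) :
  V^T *m V = 1%:M -> enorm (V *m a) = enorm a.
Proof. by move=> VV; rewrite !enormE dot_mulmxl mulmxA VV mul1mx. Qed.

Lemma gram_schmidt n m (A : 'M[R]_(n, m)) : exists p (V : 'M[R]_(n, p)) B,
  [/\ (p <= m)%N, V^T *m V = 1%:M & A = V *m B].
Proof.
elim: m A => [|m IH] A.
  exists 0%N, 0, 0; split => //; first by apply/matrixP => -[].
  by apply/matrixP => i [].
have [p [V [B [pm VV AV]]]] := IH (rsubmx (A : 'M[R]_(n, 1 + m))).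
pose c := lsubmx (A : 'M[R]_(n, 1 + m)).
have AE : A = row_mx c (V *m B) :> 'M[R]_(n, 1 + m) by rewrite -AV hsubmxK.
pose q := c - V *m (V^T *m c).
have Vq : V^T *m q = 0 by rewrite /q mulmxBr (mulmxA V^T V) VV mul1mx subrr.
(* [q] is the part of the first column orthogonal to the frame of the others. If it vanishes the
   frame is kept, so dependent columns are allowed and [p] may stay below the number of columns. *)
have [q0|q0] := eqVneq q 0.
  exists p, V, (row_mx (V^T *m c) B : 'M[R]_(p, 1 + m)); split => //.
    exact: leq_trans pm _.
  apply: (etrans AE); apply/esym; apply: (etrans (mul_mx_row _ _ _)).
  by congr row_mx; apply/esym/eqP; rewrite -subr_eq0 -/q q0.
have nq : enorm q != 0 by rewrite enorm_eq0.
pose e := (enorm q)^-1 *: q.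
exists (p + 1)%N, (row_mx V e), (block_mx (V^T *m c) B (enorm q)%:M 0 : 'M[R]_(p + 1, 1 + m)).
split; first by rewrite addn1.
  rewrite tr_row_mx mul_col_row VV.
  have Ve : V^T *m e = 0 by rewrite /e -scalemxAr Vq scaler0.
  have eV : e^T *m V = 0 by rewrite -[LHS]trmxK trmx_mul trmxK Ve trmx0.
  have ee : e^T *m e = 1%:M.
    apply/matrixP => i j; rewrite !ord1 dot_mx mxE eqxx -sqr_enorm /e enormZ.
    by rewrite normfV ger0_norm ?enorm_ge0 // mulVf // expr1n.
  by rewrite Ve eV ee -scalar_mx_block.
apply: (etrans AE); apply/esym; apply: (etrans (mul_row_block _ _ _ _ _ _)).
by rewrite mulmx0 addr0 mul_mx_scalar /e scalerA divff // scale1r /q addrC subrK.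
Qed.

(** Gram-Schmidt is applied to [col_base H], which has only rank-many columns; this bounds the size
    of the frame by the rank. *)
Lemma orthonormal_column_span n (H : 'M[R]_n) : exists p (V : 'M[R]_(n, p)) B,
  [/\ (p <= \rank H)%N, V^T *m V = 1%:M & H = V *m B].
Proof.
have [p [V [B [pr VV HE]]]] := gram_schmidt (col_base H).
exists p, V, (B *m row_base H); split => //.
by rewrite mulmxA -HE mulmx_base.
Qed.

End Orthonormal.

Section Net.
Context {R : realType}.

(** Steps of 1/N on [-1, 1]: index 0 stands for -1 and the largest index 2N for 1. *)
Definition grid_point (N p : nat) (k : {ffun 'I_p -> 'I_(N.*2).+1}) : 'cV[R]_p :=
  \col_i ((k i)%:R / N%:R - 1).

Lemma grid_approx (N p : nat) (b : 'cV[R]_p) (j : 'I_p) : (0 < N)%N ->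
  (forall i, `|b i 0| <= 1) -> b j 0 = 1 ->
  exists k : {ffun 'I_p -> 'I_(N.*2).+1}, [/\ k j = ord_max, grid_point k j 0 = 1 &
    forall i, `|b i 0 - grid_point k i 0| <= N%:R^-1].
Proof.
move=> N0 b1 bj; have N0R : 0 < N%:R :> R by rewrite ltr0n.
pose t i : R := (b i 0 + 1) * N%:R.
have t0 i : 0 <= t i.
  by rewrite mulr_ge0 //; have := b1 i; rewrite ler_norml => /andP[]; lra.
have t2 i : t i <= N.*2%:R.
  rewrite -muln2 natrM [leRHS]mulrC /t ler_pM2r //.
  by have := b1 i; rewrite ler_norml => /andP[]; lra.
have tN i : (Num.truncn (t i) < (N.*2).+1)%N.
  by rewrite truncn_lt_nat // (le_lt_trans (t2 i)) // ltr_nat.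
have kj : Num.truncn (t j) = N.*2.
  apply/eqP; rewrite eqn_leq -ltnS tN truncn_ge_nat // /t bj -muln2 natrM mulrC.
  by rewrite lexx.
exists [ffun i => Ordinal (tN i)]; split.
- by rewrite ffunE; apply/val_inj; rewrite /= kj.
- by rewrite mxE ffunE /= kj -muln2 natrM [_ * 2]mulrC mulfK ?gt_eqF //; lra.
- move=> i; rewrite mxE ffunE /=; have /andP[h1 h2] := truncn_itv (t0 i).
  have -> : b i 0 - ((Num.truncn (t i))%:R / N%:R - 1) = (t i - (Num.truncn (t i))%:R) / N%:R.
    by rewrite /t; field; rewrite gt_eqF.
  rewrite normrM (@ger0_norm _ (t i - _)) ?subr_ge0 // (@ger0_norm _ N%:R^-1) ?invr_ge0 //.
  by rewrite ler_piMl ?invr_ge0 // lerBlDr addrC natr1 ltW.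
Qed.

(** Pinning the coordinate [j] at 1 saves one power of N; this power is what makes the union bound
    over the net tend to 0 as N grows. *)
Lemma card_grid_slice (N p : nat) (j : 'I_p) :
  #|[pred k : {ffun 'I_p -> 'I_(N.*2).+1} | k j == ord_max]| = ((N.*2).+1 ^ p.-1)%N.
Proof.
pose F (i : 'I_p) : pred 'I_(N.*2).+1 := if i == j then pred1 ord_max else predT.
have -> : #|[pred k : {ffun 'I_p -> 'I_(N.*2).+1} | k j == ord_max]| = #|family F|.
  apply: eq_card => k; rewrite !inE; apply/eqP/familyP => [kj i|/(_ j)].
    by rewrite /F; case: eqP => [->|//]; rewrite inE kj.
  by rewrite /F eqxx inE => /eqP.
rewrite card_family foldrE big_image (bigD1 j) //= /F eqxx card1 mul1n.
rewrite (eq_bigr (fun=> (N.*2).+1)) => [|i /negbTE ->]; last by rewrite card_ord.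
by rewrite prod_nat_const cardC1 card_ord.
Qed.

End Net.

Section RangeSmallBall.
Context {R : realType}.

Lemma enorm_delta n (i : 'I_n) : enorm (delta_mx i 0 : 'cV[R]_n) = 1.
Proof.
rewrite enormE /dot (bigD1 i) //= big1 ?addr0 => [|j ji].
  by rewrite !mxE !eqxx mulr1 sqrtr1.
by rewrite mxE (negbTE ji) mul0r.
Qed.

Lemma col_sum_delta n (a : 'cV[R]_n) : a = \sum_i a i 0 *: delta_mx i 0.
Proof. by rewrite {1}(matrix_sum_delta a); apply: eq_bigr => i _; rewrite big_ord1. Qed.

Lemma enorm_le_sum m n (A : 'M[R]_(m, n)) (a : 'cV[R]_n) (b r : R) :
  (forall i, `|a i 0| <= b) -> (forall i, enorm (A *m delta_mx i 0) <= r) ->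
  enorm (A *m a) <= n%:R * (b * r).
Proof.
move=> ab Ar; rewrite {1}(col_sum_delta a) mulmx_sumr (le_trans (enorm_sum _)) //.
rewrite mulr_natl -[n in leRHS]card_ord -sumr_const; apply: ler_sum => i _.
rewrite -scalemxAr enormZ ler_pM ?enorm_ge0 //.
Qed.

Lemma entry_le_enorm n (a : 'cV[R]_n) i : `|a i 0| <= enorm a.
Proof.
rewrite -(@ler_pXn2r _ 2) ?nnegrE ?enorm_ge0 // sqr_enorm /dot real_normK ?num_real //.
by rewrite (bigD1 i) //= expr2 lerDl sumr_ge0 // => j _; rewrite -expr2 sqr_ge0.
Qed.

Lemma exists_max_entry n (a : 'cV[R]_n) : a != 0 ->
  exists j, a j 0 != 0 /\ forall i, `|a i 0| <= `|a j 0|.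
Proof.
move=> a0; have [i0 ai0] : exists i, a i 0 != 0.
  apply/existsP; apply: contraNT a0 => /existsPn h; apply/eqP/colP => i.
  by rewrite mxE; apply/eqP; move: (h i); rewrite negbK.
have [j _ jmax] := @Order.TotalTheory.arg_maxP _ _ _ i0 xpredT (fun i => `|a i 0|) isT.
exists j; split => [|i]; last exact: jmax.
by rewrite -normr_gt0 (lt_le_trans _ (jmax i0 isT)) // normr_gt0.
Qed.

Context {d : measure_display} {T : measurableType d} (Pr : probability T R)
  {s n : nat} (P : T -> 'M[R]_(s, n)).
Hypotheses (s0 : (0 < s)%N) (Pg : gaussian_mx Pr P).

Let sR0 : 0 < s%:R :> R. Proof. by rewrite ltr0n. Qed.

(* Every direction has a representative a with largest entry 1; rounding the
   other entries to multiples of 1/N leaves only of order N^(p-1) points, whereas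
   each of them violates the bound with probability of order N^(-s). *)
Lemma gaussian_orthonormal_net p (V : 'M[R]_(n, p)) (N : nat) (r : R) :
  V^T *m V = 1%:M -> (p <= s)%N -> (0 < N)%N -> 0 < r ->
  exists E : set T, [/\ measurable E,
    (Pr E <= (s%:R * (2 / r ^+ 2) +
       s%:R * (((N.*2).+1 ^ s.-1)%:R * (4 * s%:R * r / N%:R) ^+ s))%:E)%E &
    forall w, ~ E w -> forall a, r / N%:R * enorm a <= enorm (P w *m (V *m a))].
Proof.
move=> VV ps N0 r0; have N0R : 0 < N%:R :> R by rewrite ltr0n.
have enV := enorm_orthonormal _ VV.
(* Twice the largest possible effect s r / N of the rounding, so that s r / N is left over after
   rounding. *)
pose de := 2 * s%:R * r / N%:R.
have de0 : 0 < de by rewrite divr_gt0 // !mulr_gt0.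
pose F1 (i : 'I_p) : set T := [set w | r <= enorm (P w *m (V *m delta_mx i 0))].
pose F2 (j : 'I_p) (k : {ffun 'I_p -> 'I_(N.*2).+1}) : set T :=
  [set w | enorm (P w *m (V *m grid_point k)) <= de].
(* Norm at least 1 makes the absolute threshold [de] smaller than the relative one of the small ball
   estimate. *)
pose Q (j : 'I_p) : pred {ffun 'I_p -> 'I_(N.*2).+1} :=
  [pred k : {ffun 'I_p -> 'I_(N.*2).+1} | (k j == ord_max) && (1 <= enorm (V *m grid_point k))].
have F1p i : xpredT i -> (Pr (F1 i) <= (2 / r ^+ 2)%:E)%E.
  move=> _; have ne : enorm (V *m delta_mx i 0) = 1 by rewrite enV enorm_delta.
  have := @gaussian_large_ball _ _ _ _ _ _ _ s0 Pg (V *m delta_mx i 0) r _ r0.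
  by rewrite ne mulr1; apply; rewrite -enorm_gt0 ne.
have F1m i : xpredT i -> measurable (F1 i) by move=> _; exact: (gaussian_ge_measurable Pg).
have [m1 p1] := prob_finite_union_le F1m F1p.
have F2m j k : Q j k -> measurable (F2 j k) by move=> _; exact: (gaussian_le_measurable Pg).
have F2p j k : Q j k -> (Pr (F2 j k) <= ((4 * s%:R * r / N%:R) ^+ s)%:E)%E.
  case/andP => _ ge1; set u := V *m grid_point k in ge1 *.
  have u0 : u != 0 by rewrite -enorm_gt0 (lt_le_trans _ ge1).
  have -> : 4 * s%:R * r / N%:R = 2 * de by rewrite /de; lra.
  apply: le_trans (gaussian_small_ball s0 Pg u0 de0); apply: le_measure.
  - by rewrite inE; exact: (gaussian_le_measurable Pg).
  - by rewrite inE; exact: (gaussian_le_measurable Pg).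
  - by move=> w /= h; apply: (le_trans h); apply: ler_peMr => //; exact: ltW.
have F3 (j : 'I_p) : xpredT j -> measurable (\bigcup_(k in [set` Q j]) F2 j k) /\
    (Pr (\bigcup_(k in [set` Q j]) F2 j k) <=
      (((N.*2).+1 ^ s.-1)%:R * (4 * s%:R * r / N%:R) ^+ s)%:E)%E.
  move=> _; have [m2 p2] := prob_finite_union_le (F2m j) (F2p j); split => //.
  apply: (le_trans p2); rewrite lee_fin ler_wpM2r //.
    by rewrite exprn_ge0 // divr_ge0 ?ltW // !mulr_gt0.
  rewrite ler_nat (@leq_trans ((N.*2).+1 ^ p.-1)%N) //.
    rewrite -(card_grid_slice N j); apply: subset_leq_card.
    by apply/fintype.subsetP => k; rewrite !inE => /andP[].
  by rewrite leq_exp2l ?ltnS ?double_gt0 //; lia.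
have [m3 p3] := prob_finite_union_le (fun j h => (F3 j h).1) (fun j h => (F3 j h).2).
have psR : p%:R <= s%:R :> R by rewrite ler_nat.
exists (\bigcup_(i in [set` xpredT]) F1 i `|`
        \bigcup_(j in [set` xpredT]) \bigcup_(k in [set` Q j]) F2 j k); split.
- exact: measurableU.
- rewrite (le_trans (measureU2 _ _ _)) // EFinD leeD //.
    rewrite (le_trans p1) // lee_fin card_ord ler_wpM2r //.
    by rewrite divr_ge0 // sqr_ge0.
  rewrite (le_trans p3) // lee_fin card_ord ler_wpM2r //.
  by rewrite mulr_ge0 // exprn_ge0 // divr_ge0 ?ltW // !mulr_gt0.
move=> w nE a; have [->|a0] := eqVneq a 0.
  by rewrite enorm0 mulr0 enorm_ge0.
have [j [aj0 jmax]] := exists_max_entry a0.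
pose b := (a j 0)^-1 *: a.
have bj : b j 0 = 1 by rewrite mxE mulVf.
have b1 i : `|b i 0| <= 1.
  by rewrite mxE normrM normfV mulrC ler_pdivrMr ?normr_gt0 // mul1r.
have [k [kj gj gb]] := grid_approx N0 b1 bj.
have g1 : (1 : R) <= enorm (grid_point k).
  by apply: le_trans (entry_le_enorm _ j); rewrite gj normr1.
have lowg : de < enorm (P w *m (V *m grid_point k)).
  rewrite ltNge; apply/negP => h; apply: nE; right; exists j => //; exists k => //.
  by rewrite /= inE kj eqxx enV g1.
have colr i : enorm (P w *m V *m delta_mx i 0) <= r.
  rewrite -mulmxA leNgt; apply/negP => h; apply: nE; left; exists i => //.
  exact: ltW.
have dif : enorm (P w *m V *m (b - grid_point k)) <= s%:R * (N%:R^-1 * r).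
  apply: (@le_trans _ _ (p%:R * (N%:R^-1 * r))).
    by apply: enorm_le_sum => // i; rewrite mxE [X in _ + X]mxE; exact: gb.
  by rewrite ler_wpM2r // mulr_ge0 ?invr_ge0 ?ltW.
have bs : enorm b <= s%:R.
  apply: le_trans psR; have := @enorm_le_sum _ _ 1%:M b 1 1 b1.
  by rewrite mul1mx !mulr1; apply=> i; rewrite mul1mx enorm_delta.
(* |b| <= s, so it suffices that the image of b has norm at least s r / N: more than 2 s r / N at
   the grid point, less at most s r / N for the rounding error. *)
have lowb : r / N%:R * enorm b <= enorm (P w *m (V *m b)).
  apply: (@le_trans _ _ (r / N%:R * s%:R)).
    by rewrite ler_wpM2l // divr_ge0 ?ltW.
  have := enormB (P w *m (V *m b)) (P w *m V *m (b - grid_point k)).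
  rewrite -!mulmxA -mulmxBr -mulmxBr opprB addrC subrK.
  move: lowg dif; rewrite /de -!mulmxA => h1 h2 h3.
  by have := le_trans (ltW h1) h3; lra.
have -> : a = a j 0 *: b by rewrite /b scalerA divff // scale1r.
by move: b lowb {bj b1 gb dif bs} => b lowb; rewrite -!scalemxAr !enormZ mulrCA ler_wpM2l.
Qed.

End RangeSmallBall.

(** [tau] is chosen before [n] and [H]: in an orthonormal frame of the range, only its dimension, at
    most [s], enters. First r, then N, makes each of the two failure terms of the net at most
    eta/2. *)
Lemma gaussian_range_small_ball (R : realType) (s : nat) (eta : R) :
  (0 < s)%N -> 0 < eta ->
  exists2 tau : R, 0 < tau &
  forall (n : nat) (d : measure_display) (T : measurableType d)
    (Pr : probability T R) (P : T -> 'M[R]_(s, n)) (H : 'M[R]_n),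
  gaussian_mx Pr P -> (\rank H <= s)%N ->
  exists E : set T, [/\ measurable E, (Pr E <= eta%:E)%E &
    forall w, ~ E w -> forall x, tau * enorm (H *m x) <= enorm (P w *m (H *m x))].
Proof.
move=> s0 eta0; have sR0 : 0 < s%:R :> R by rewrite ltr0n.
have sR1 : 1 <= s%:R :> R by rewrite ler1n.
(* The first summand gives 4 s <= eta r, and the added 1 ensures r <= r^2. *)
pose r : R := 4 * s%:R / eta + 1.
have r1 : 1 <= r by rewrite lerDr divr_ge0 ?ltW // mulr_gt0.
have r0 : 0 < r by apply: lt_le_trans r1.
(* Since 2N + 1 <= 3N, the net contributes at most c/N to the failure probability. *)
pose c : R := s%:R * (3 ^+ s.-1 * (4 * s%:R * r) ^+ s).
have c0 : 0 < c by rewrite !mulr_gt0 ?exprn_gt0 // !mulr_gt0.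
pose N := (Num.truncn (2 * c / eta)).+1.
have N0 : 0 < N%:R :> R by rewrite ltr0n.
exists (r / N%:R) => [|n d T Pr P H Pg rH]; first by rewrite divr_gt0.
have [p [V [B [pr VV HE]]]] := orthonormal_column_span H.
have [E [mE pE EP]] := gaussian_orthonormal_net s0 Pg VV (leq_trans pr rH) (isT : (0 < N)%N) r0.
exists E; split => //; last first.
  move=> w nE x; rewrite HE -(mulmxA V B x) (enorm_orthonormal _ VV).
  exact: EP.
apply: (le_trans pE); rewrite lee_fin.
have half1 : s%:R * (2 / r ^+ 2) <= eta / 2.
  rewrite mulrA ler_pdivrMr ?exprn_gt0 //.
  have : 4 * s%:R <= eta * r by rewrite /r mulrDr mulrCA divff ?gt_eqF // !mulr1 lerDl ltW.
  have : eta * r <= eta * r ^+ 2 by rewrite ler_pM2l // expr2 ler_peMr // ltW.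
  by lra.
have half2 : s%:R * (((N.*2).+1 ^ s.-1)%:R * (4 * s%:R * r / N%:R) ^+ s) <= eta / 2.
  apply: (@le_trans _ _ (c / N%:R)).
    rewrite /c -!mulrA ler_pM2l //.
    have E3 (A : R) k : 3 ^+ k * (A ^+ k.+1 / N%:R) = (3 * N%:R) ^+ k * (A / N%:R) ^+ k.+1.
      rewrite exprMn expr_div_n [N%:R ^+ k.+1]exprS; field.
      by rewrite expf_neq0 gt_eqF.
    have := E3 (4 * (s%:R * r)) s.-1; rewrite prednK // -!mulrA => ->.
    rewrite ler_pM2r ?exprn_gt0 ?mulr_gt0 ?invr_gt0 //.
    rewrite natrX lerXn2r ?nnegrE ?mulr_ge0 // -natrM ler_nat.
    by rewrite -addnn !mulSn mul0n addn0 addnA -addn1 leq_add2l.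
  rewrite ler_pdivrMr // mulrAC ler_pdivlMr // -ler_pdivrMl // mulrC.
  have q0 : 0 <= 2 * c / eta by apply: divr_ge0; [apply: mulr_ge0 => //; exact: ltW|exact: ltW].
  by have /andP[_ h] := truncn_itv q0; rewrite [c * 2]mulrC ltW.
by lra.
Qed.

(** * One iteration *)

Section Iteration.
Context {R : realType} {n s : nat}.
Variables (g : 'cV[R]_n) (H : 'M[R]_n) (P : 'M[R]_(s, n)) (z : 'cV[R]_(s + 1)).
Variable de : R.
Hypotheses (Hsym : H^T = H) (de0 : 0 < de)
  (zmin : ball_minimizer (sub_mx g H de P) z).

(** The cases t = 0 and t != 0 are merged, with u = v or u = v/t. What the descent needs holds in
    both; the two differ only in the disjunction, which matters at termination. The last row of the
    eigenvector equation yields the sign of dot g d. *)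
Lemma direction_kkt : exists th u,
  [/\ de <= th,
      direction P z = P^T *m u /\
        dot (direction P z) (H *m direction P z) =
          - th * enorm u ^+ 2 - dot g (direction P z),
      dot g (direction P z) <= 0,
      enorm u = 1 \/ (P *m (H *m direction P z) + P *m g = - th *: u /\
                      dot (P *m g) u = de - th) &
      forall y, - th * enorm y ^+ 2 <= dot y (P *m H *m P^T *m y)].
Proof.
have Fsym : (sub_mx g H de P)^T = sub_mx g H de P.
  rewrite /sub_mx tr_block_mx !trmxK tr_scalar_mx !trmx_mul trmxK Hsym.
  by rewrite mulmxA.
(* The test vector [0; 1] has value -de < 0, so the minimum is negative and th >= de. *)
pose y0 : 'cV[R]_(s + 1) := col_mx 0 1%:M.
have y01 : enorm y0 <= 1.
  by rewrite enormE dot_col_mx dot0l add0r -dot_mx tr_scalar_mx mul1mx mxE eqxx sqrtr1.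
have y0F : dot y0 (sub_mx g H de P *m y0) = - de.
  rewrite /sub_mx /y0 mul_block_col !mulmx0 !add0r dot_col_mx dot0l add0r mulmx1.
  by rewrite -dot_mx tr_scalar_mx mul1mx mxE eqxx mulr1n.
have [th [thde Fz z1 psd]] := ball_minimizer_kkt Fsym zmin y01
  (eq_ind_r (fun r => r < 0) (etrans (oppr_lt0 de) de0) y0F).
rewrite y0F opprK in thde.
set v := usubmx z; set t := dsubmx z 0 0.
have zE : z = col_mx v t%:M by rewrite -mx11_scalar vsubmxK.
have F1 : P *m H *m P^T *m v + t *: (P *m g) = - th *: v.
  have := congr1 usubmx Fz.
  by rewrite /sub_mx {1}zE mul_block_col col_mxKu linearZ /= mul_mx_scalar.
have F2 : dot (P *m g) v = t * (de - th).
  have := congr1 dsubmx Fz.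
  rewrite /sub_mx {1}zE mul_block_col col_mxKd linearZ /= => /matrixP/(_ 0 0).
  have tE : t = z (rshift s 0) 0 by rewrite /t mxE.
  by rewrite mxE dot_mx -scalar_mxM !mxE -tE eqxx mulr1n; lra.
have psd' y : - th * enorm y ^+ 2 <= dot y (P *m H *m P^T *m y).
  have := psd (col_mx y 0); rewrite /sub_mx mul_block_col !mulmx0 !addr0.
  by rewrite dot_col_mx dot0l addr0 sqr_enorm dot_col_mx dot0l addr0 -sqr_enorm.
have [t0|t0] := eqVneq t 0.
  have dE : direction P z = P^T *m v by rewrite /direction -/t t0 eqxx.
  have gd : dot g (direction P z) = 0.
    by rewrite dE dotC dot_mulmxl trmxK dotC F2 t0 mul0r.
  have v1 : enorm v = 1.
    have t00 : 0%:M = 0 :> 'cV[R]_1 by apply/matrixP => i j; rewrite !mxE mul0rn.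
    by have := z1; rewrite zE t0 t00 enormE dot_col_mx dot0l addr0 -enormE.
  exists th, v; split => //; [split => //|by rewrite gd|by left].
  rewrite gd subr0 dE dot_mulmxl trmxK !mulmxA.
  by move: F1; rewrite t0 scale0r addr0 => ->; rewrite dotZr sqr_enorm.
pose u := t^-1 *: v.
have dE : direction P z = P^T *m u by rewrite /direction -/t t0 -scalemxAr.
have F1' : P *m (H *m direction P z) + P *m g = - th *: u.
  rewrite dE !mulmxA /u -scalemxAr -[P *m g]scale1r -(mulVf t0) -scalerA -scalerDr.
  by rewrite F1 !scalerA mulrC.
have F2' : dot (P *m g) u = de - th by rewrite dotZr F2 mulrA mulVf // mul1r.
have gd : dot g (direction P z) = de - th.
  by rewrite dE dotC dot_mulmxl trmxK dotC F2'.
exists th, u; split => //; [split => //|by rewrite gd; lra|by right].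
rewrite {1}dE dot_mulmxl trmxK -[P *m (H *m _)](addrK (P *m g)) F1' gd -F2'.
by rewrite dotDr dotNr dotZr (dotC u (P *m g)) sqr_enorm.
Qed.

End Iteration.

Section Step.
Context {R : realType} {n s : nat}.
Variables (f : 'cV[R]_n -> R) (M e b de Del : R) (x : 'cV[R]_n)
  (P : 'M[R]_(s, n)) (z : 'cV[R]_(s + 1)).
Hypotheses (fC2 : C2 f) (M0 : 0 < M)
  (hess_lip : forall y1 y2, opnorm (hess f y1 - hess f y2) <= M * enorm (y1 - y2)).
Hypotheses (e0 : 0 < e) (b1 : 1 <= b) (deE : de = b ^+ 2 * e) (DelE : Del = e / M).
Hypothesis Pb : forall y, enorm (P^T *m y) <= b * enorm y.
Hypothesis zmin : ball_minimizer (sub_mx (grad f x) (hess f x) de P) z.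

Let b0 : 0 < b. Proof. exact: lt_le_trans b1. Qed.
Let de0 : 0 < de. Proof. by rewrite deE mulr_gt0 ?exprn_gt0. Qed.
Let Del0 : 0 < Del. Proof. by rewrite DelE divr_gt0. Qed.
Let Hsym : (hess f x)^T = hess f x. Proof. exact: hess_sym fC2 (ltW M0) hess_lip x. Qed.

(** Let K = e^3 / M^2. The gradient terms add up to (eta - eta^2/2) q <= 0, as q <= 0 and eta < 1.
    The curvature term is at most -K/2, because b (eta |u|) >= Del and th >= b^2 e; the cubic
    remainder is K/6. The sum is -K/3. *)
Lemma descent_step : Del < enorm (direction P z) ->
  f (x + (Del / enorm (direction P z)) *: direction P z) <= f x - e ^+ 3 / (3 * M ^+ 2).
Proof.
move=> Dd; have [th [u [thde [dE dHd] gd _ _]]] := direction_kkt Hsym de0 zmin.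
set dd := direction P z in Dd dE dHd gd *.
have nd : 0 < enorm dd by apply: lt_trans Dd.
set eta := Del / enorm dd.
have eta0 : 0 < eta by rewrite divr_gt0.
have eta1 : eta < 1 by rewrite ltr_pdivrMr // mul1r.
have etad : eta * enorm dd = Del by rewrite divfK // gt_eqF.
have := cubic_upper_bound fC2 hess_lip x (eta *: dd).
rewrite dotZr -scalemxAr dotZl dotZr enormZ gtr0_norm // etad dHd.
set q := dot (grad f x) dd in gd *.
have ub : Del <= b * (eta * enorm u).
  by rewrite -etad mulrCA ler_pM2l // dE Pb.
have u0 : 0 <= eta * enorm u by rewrite mulr_ge0 ?enorm_ge0 // ltW.
have key : e * Del ^+ 2 <= th * (eta * enorm u) ^+ 2.
  apply: (@le_trans _ _ (de * (eta * enorm u) ^+ 2)).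
    rewrite deE mulrAC -exprMn mulrC ler_pM2r // lerXn2r ?nnegrE ?(ltW Del0) //.
    by rewrite mulr_ge0 // ltW.
  by rewrite ler_wpM2r ?sqr_ge0.
have lin : eta * q - eta ^+ 2 * q / 2 <= 0.
  have -> : eta * q - eta ^+ 2 * q / 2 = eta * (1 - eta / 2) * q by ring.
  by rewrite mulr_ge0_le0 // mulr_ge0 ?(ltW eta0) //; lra.
have E1 : e * Del ^+ 2 = e ^+ 3 / M ^+ 2.
  by rewrite DelE; field; rewrite gt_eqF.
have E2 : M / 6 * Del ^+ 3 = (e ^+ 3 / M ^+ 2) / 6.
  by rewrite DelE; field; rewrite gt_eqF.
have E3 : e ^+ 3 / (3 * M ^+ 2) = (e ^+ 3 / M ^+ 2) / 3.
  by field; rewrite gt_eqF.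
rewrite E2 E3; rewrite E1 in key; move: (e ^+ 3 / M ^+ 2) key => K key.
have -> : eta * (eta * (- th * enorm u ^+ 2 - q)) / 2 =
  - (th * (eta * enorm u) ^+ 2) / 2 - eta ^+ 2 * q / 2 by ring.
move: (th * _) key (eta * q) (eta ^+ 2 * q / 2) lin => A key B C lin.
by move: (f _) (f x) => fx' fx; lra.
Qed.

Variables (a L nu : R).
Hypotheses (a1 : 1 <= a) (L0 : 0 <= L) (b_nu : b ^+ 2 <= 9 / 4 * nu).
Hypothesis Pa : forall y, a * enorm y <= enorm (P^T *m y).
Hypothesis grad_lip :
  forall y1 y2, enorm (grad f y1 - grad f y2) <= L * enorm (y1 - y2).
Hypothesis Del_half : Del <= 2^-1.

(* A unit vector u = v (the case t = 0) would give a direction longer than Del,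
   so termination forces t != 0. *)
Lemma termination_bounds : enorm (direction P z) <= Del ->
  enorm (P *m grad f x) <= 3 * (1 + L / M) * nu * e /\
  exists th, [/\ 0 <= th, th <= 6 * (1 + L / M) * nu * e &
    forall y, - th * enorm y ^+ 2 <= dot y (P *m hess f x *m P^T *m y)].
Proof.
move=> dD; have [th [u [thde [dE _] _ KKT psd]]] := direction_kkt Hsym de0 zmin.
set dd := direction P z in dD dE KKT.
have uD : enorm u <= Del.
  apply: le_trans dD; rewrite dE; apply: le_trans (Pa u).
  by rewrite ler_peMl ?enorm_ge0.
have uh : enorm u <= 2^-1 by apply: le_trans Del_half.
case: KKT => [u1|[KKT1 KKT2]]; first by move: uh; rewrite u1; lra.
set Pg := P *m grad f x in KKT1 KKT2 *.
have nPg : enorm Pg <= th * enorm u + b * (L * Del).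
  (* The step has length at most Del, so its Hessian term is only of size b L Del. *)
  have -> : Pg = - th *: u - P *m (hess f x *m dd) by rewrite -KKT1 addrC addKr.
  apply: (le_trans (enormB _ _)); rewrite enormZ normrN ger0_norm; last first.
    exact: le_trans (ltW de0) thde.
  rewrite lerD2l (le_trans (enorm_mulmx_trmx (ltW b0) Pb _)) // ler_pM2l //.
  apply: le_trans (enorm_hess_le fC2 (ltW M0) hess_lip _ _ grad_lip) _.
  by rewrite ler_wpM2l.
have th_le : th <= de + enorm Pg * enorm u.
  have : th = de - dot Pg u by rewrite KKT2; lra.
  move=> ->; rewrite lerD2l; apply: le_trans (ler_norm _) _.
  by rewrite normrN cauchy_schwarz.
have nu0 : 0 <= nu by have := sqr_ge0 b; move: b_nu; lra.
have de_nu : de <= 9 / 4 * (nu * e).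
  by rewrite deE mulrA ler_pM2r.
have bL : b * (L * Del) <= 9 / 4 * (L / M) * (nu * e).
  have -> : b * (L * Del) = b * (L / M * e) by rewrite DelE; ring.
  have -> : 9 / 4 * (L / M) * (nu * e) = 9 / 4 * nu * (L / M * e) by ring.
  apply: ler_wpM2r; first by apply: mulr_ge0; [apply: divr_ge0 => //|]; exact: ltW.
  by apply: le_trans b_nu; rewrite expr2 ler_peMl // ltW.
have Pg0 := enorm_ge0 Pg; have u0 := enorm_ge0 u.
have X0 : 0 <= nu * e by rewrite mulr_ge0 // ltW.
have Y0 : 0 <= L / M * (nu * e) by rewrite mulr_ge0 // divr_ge0 // ltW.
have t1 : th * enorm u <= th * 2^-1.
  by rewrite ler_wpM2l // (le_trans (ltW de0)).
have t2 : enorm Pg * enorm u <= enorm Pg * 2^-1 by rewrite ler_wpM2l.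
have -> : 3 * (1 + L / M) * nu * e = 3 * (nu * e) + 3 * (L / M * (nu * e)) by ring.
have -> : 6 * (1 + L / M) * nu * e = 6 * (nu * e) + 6 * (L / M * (nu * e)) by ring.
have bL' : b * (L * Del) <= 9 / 4 * (L / M * (nu * e)).
  by rewrite [leRHS]mulrA.
(* The bounds on |P g| and [th] involve each other; as |u| <= 1/2 they read |P g| <= th/2 + b L Del
   and th <= de + |P g|/2, a contraction that can be solved. *)
have B : enorm Pg <= 3 * (nu * e) + 3 * (L / M * (nu * e)).
  have : th * 2^-1 <= (9 / 4 * (nu * e) + enorm Pg * 2^-1) * 2^-1.
    by rewrite ler_pM2r ?invr_gt0 //; move: th_le t2 de_nu; lra.
  by move: nPg t1 bL' X0 Y0 Pg0; lra.
split; first exact: B.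
exists th; split => //; first exact: le_trans (ltW de0) thde.
by move: th_le t2 de_nu B X0 Y0; lra.
Qed.

End Step.

(** * Measurability *)

Section Measurability.
Context {R : realType} {d : measure_display} {T : measurableType d}.

(** The inverse is total, with value 0 at 0, where it is discontinuous; this point is split off. *)
Lemma measurable_inv : measurable_fun setT (@GRing.inv R).
Proof.
have o0 : open [set x : R | x != 0] by exact: open_neq.
have -> : [set: R] = [set x : R | x != 0] `|` [set 0].
  by apply/seteqP; split => x //= _; have [->|] := eqVneq x 0; [right|left].
apply/measurable_funU => //; first exact: open_measurable.
split; last exact: measurable_fun_set1.
apply: open_continuous_measurable_fun => //.
by move=> x; rewrite inE /= => x0; exact: inv_continuous.
Qed.

Lemma measurable_enorm_mulmx m n (A : T -> 'M[R]_(m, n)) (v : T -> 'cV[R]_n) :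
  (forall i j, measurable_fun setT (fun w => A w i j)) ->
  (forall j, measurable_fun setT (fun w => v w j 0)) ->
  forall i, measurable_fun setT (fun w => (A w *m v w) i 0).
Proof.
move=> mA mv i; under eq_fun do rewrite mxE.
by apply: measurable_sum => j; exact: measurable_funM.
Qed.

Lemma measurable_lt_set (f g : T -> R) : measurable_fun setT f ->
  measurable_fun setT g -> measurable [set w | f w < g w].
Proof.
move=> mf mg.
have := measurable_funB mg mf measurableT (measurable_itv `]0, +oo[).
rewrite setTI; congr measurable; apply/seteqP; split => w /=;
  by rewrite in_itv /= andbT subr_gt0.
Qed.

Lemma rat_vector_dense n (x : 'cV[R]_n) (e : R) : 0 < e ->
  exists q : 'cV[rat]_n, forall i, `|x i 0 - ratr (q i 0)| < e.
Proof.
move=> e0; have H i : exists q : rat, `|x i 0 - ratr q| < e.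
  have /rat_in_itvoo[q] : x i 0 < x i 0 + e by rewrite ltrDl.
  rewrite in_itv /= => /andP[h1 h2]; exists q.
  by rewrite ler0_norm ?subr_le0 ?ltW // opprB ltrBlDl.
have [q hq] := choice H; exists (\col_i q i) => i; by rewrite mxE.
Qed.

(* An open subset of R^n is the union of the rational boxes it contains. *)
Lemma measurable_continuous_comp n (phi : 'cV[R]_n -> R) (X : T -> 'cV[R]_n) :
  continuous phi -> (forall i, measurable_fun setT (fun w => X w i 0)) ->
  measurable_fun setT (fun w => phi (X w)).
Proof.
move=> cphi mX _; apply: (measurability _ (RGenOInfty.measurableE R)) => //.
move=> /= _ [_ [a ->] <-]; rewrite setTI.
pose box (p : 'cV[rat]_n * nat) : set 'cV[R]_n :=
  [set y | forall i, `|y i 0 - ratr (p.1 i 0)| < p.2.+1%:R^-1].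
pose good (p : 'cV[rat]_n * nat) := box p `<=` [set y | a < phi y].
have -> : (fun w => phi (X w)) @^-1` `]a, +oo[ =
    \bigcup_p (if pselect (good p) then X @^-1` box p else set0).
  apply/seteqP; split => w /=; last first.
    by case=> p _; case: pselect => // gp /gp /=; rewrite in_itv /= andbT.
  rewrite in_itv /= andbT => aw.
  have : \forall y \near X w, a < phi y.
    exact: (cphi (X w) _ (lt_nbhsr aw)).
  move=> /nbhs_ballP[e /= e0 be].
  pose m := Num.truncn (2 / e).
  have m1 : m.+1%:R^-1 < e / 2.
    have /andP[_ h] := @truncn_itv R (2 / e) (divr_ge0 (ler0n _ 2) (ltW e0)).
    by rewrite -[e / 2]invrK invf_div ltf_pV2 ?posrE ?divr_gt0 ?ltr0n.
  have m0 : 0 < m.+1%:R^-1 :> R by rewrite invr_gt0 ltr0n.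
  have [q hq] := rat_vector_dense (X w) m0.
  exists (q, m) => //; case: pselect => // -[] y /= hy.
  apply: be; rewrite /ball /= /mx_ball; split => // i j; rewrite (ord1 j) /ball /=.
  rewrite -(subrK (ratr (q i 0)) (X w i 0)) -addrA (le_lt_trans (ler_normD _ _)) //=.
  rewrite (splitr e) ltrD // (lt_trans _ m1) //.
  by rewrite distrC.
apply: countable_bigcupT_measurable => // p; case: (pselect (good p)) => [gp|ngp] //=.
have -> : X @^-1` box p = \bigcap_(i in [set: 'I_n])
    [set w | `|X w i 0 - ratr (p.1 i 0)| < p.2.+1%:R^-1].
  by apply/seteqP; split => w /= h i; [move=> _; exact: h|exact: (h i Logic.I)].
apply: fin_bigcap_measurable => // i _; apply: measurable_lt_set => //.
by apply: measurableT_comp => //; apply: measurable_funB.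
Qed.

Lemma measurable_det n (A : T -> 'M[R]_n) :
  (forall i j, measurable_fun setT (fun w => A w i j)) ->
  measurable_fun setT (fun w => \det (A w)).
Proof.
move=> mA; apply: measurable_sum => sg; apply: measurable_funM => //.
by apply: measurable_prod => i _.
Qed.

(** Turns the rank into finitely many polynomial conditions on the entries, hence into measurable
    sets. The index maps need not be injective: repeated rows or columns give determinant 0. *)
Lemma rank_gt_minor n (A : 'M[R]_n) k : (k < \rank A)%N <->
  exists p : 'I_n.+1, (k < p)%N /\ exists f g : {ffun 'I_p -> 'I_n}, \det (mxsub f g A) != 0.
Proof.
split=> [kA|[p [kp [f [g dA]]]]].
  have pn : (\rank A < n.+1)%N by rewrite ltnS rank_leq_row.
  exists (Ordinal pn); split => //=.
  pose B := rowsub (maxrankfun A) A.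
  have Bfree : row_free B by exact: maxrowsub_free.
  have BTfull : row_full B^T by rewrite /row_full mxrank_tr.
  exists (maxrankfun A), (fullrankfun BTfull).
  rewrite -unitfE -[_ \is a _]/(mxsub _ _ A \in unitmx).
  have -> : mxsub (maxrankfun A) (fullrankfun BTfull) A = (rowsub (fullrankfun BTfull) B^T)^T.
    by apply/matrixP => i j; rewrite !mxE.
  by rewrite unitmx_tr fullrowsub_unit.
apply: (leq_trans kp); have : mxsub f g A \in unitmx by rewrite unitmxE unitfE.
move/mxrank_unit => <-.
have -> : mxsub f g A = (rowsub g (rowsub f A)^T)^T by apply/matrixP => i j; rewrite !mxE.
rewrite mxrank_tr (leq_trans (mxrankS (rowsub_sub _ _))) // mxrank_tr.
exact: mxrankS (rowsub_sub _ _).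
Qed.

Lemma measurable_rank_le n (A : T -> 'M[R]_n) k :
  (forall i j, measurable_fun setT (fun w => A w i j)) ->
  measurable [set w | (\rank (A w) <= k)%N].
Proof.
move=> mA; rewrite -[X in measurable X]setCK; apply: measurableC.
have -> : ~` [set w | (\rank (A w) <= k)%N] =
    \bigcup_(p in [set p : 'I_n.+1 | (k < p)%N])
    \bigcup_(f in [set: {ffun 'I_p -> 'I_n}])
    \bigcup_(g in [set: {ffun 'I_p -> 'I_n}]) [set w | \det (mxsub f g (A w)) != 0].
  apply/seteqP; split => w /=.
    move/negP; rewrite -ltnNge => /rank_gt_minor[p [kp [f [g h]]]].
    by exists p => //; exists f => //; exists g.
  case=> p kp [f _ [g _ h]]; apply/negP; rewrite -ltnNge; apply/rank_gt_minor.
  by exists p; split => //; exists f, g.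
apply: fin_bigcup_measurable => // p _; apply: fin_bigcup_measurable => // f _.
apply: fin_bigcup_measurable => // g _.
have mdet : measurable_fun setT (fun w => \det (mxsub f g (A w))).
  by apply: measurable_det => i j; under eq_fun do rewrite mxE; exact: mA.
have -> : [set w | \det (mxsub f g (A w)) != 0] =
    [set w | \det (mxsub f g (A w)) < 0] `|` [set w | 0 < \det (mxsub f g (A w))].
  by apply/seteqP; split => w /=; rewrite neq_lt; [move/orP|move=> ?; apply/orP].
by apply: measurableU; apply: measurable_lt_set.
Qed.

(** A strict inequality between continuous functions survives a small rational perturbation, so an
    uncountable existential becomes a countable union. [K] bounds the combined Lipschitz constant;
    its last summand keeps it positive. *)
Lemma rat_vector_witness n m1 m2 (A : 'M[R]_(m1, n)) (B : 'M[R]_(m2, n)) (tau : R) :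
  0 < tau ->
  (exists x, enorm (A *m x) < tau * enorm (B *m x)) ->
  exists q : 'cV[rat]_n, enorm (A *m map_mx ratr q) < tau * enorm (B *m map_mx ratr q).
Proof.
move=> tau0 [x hx].
have colb m (C : 'M[R]_(m, n)) i : enorm (C *m delta_mx i 0) <=
    \sum_j enorm (C *m delta_mx j 0).
  by rewrite (bigD1 i) //= lerDl sumr_ge0 // => j _; exact: enorm_ge0.
pose K : R := n%:R * (\sum_j enorm (A *m delta_mx j 0) + tau * \sum_j enorm (B *m delta_mx j 0)) + 1.
have K0 : 0 < K.
  rewrite ltr_wpDl // mulr_ge0 // addr_ge0 ?sumr_ge0 // => [j _|]; first exact: enorm_ge0.
  by rewrite mulr_ge0 ?(ltW tau0) // sumr_ge0 // => j _; exact: enorm_ge0.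
pose gap := tau * enorm (B *m x) - enorm (A *m x).
have gap0 : 0 < gap by rewrite subr_gt0.
have e0 : 0 < gap / K by rewrite divr_gt0.
have [q hq] := rat_vector_dense x e0; exists q; set y := map_mx ratr q.
have xy i : `|(x - y) i 0| <= gap / K by rewrite !mxE ltW.
have hA := enorm_le_sum xy (colb _ A); have hB := enorm_le_sum xy (colb _ B).
have tA : enorm (A *m y) <= enorm (A *m x) + enorm (A *m (x - y)).
  have -> : A *m y = A *m x - A *m (x - y) by rewrite -mulmxBr opprB addrC subrK.
  exact: enormB.
have tB : enorm (B *m x) <= enorm (B *m y) + enorm (B *m (x - y)).
  have -> : B *m x = B *m y + B *m (x - y) by rewrite -mulmxDr addrC subrK.
  exact: enormD.
have small : n%:R * (gap / K * \sum_j enorm (A *m delta_mx j 0)) +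
    tau * (n%:R * (gap / K * \sum_j enorm (B *m delta_mx j 0))) < gap.
  have -> : n%:R * (gap / K * \sum_j enorm (A *m delta_mx j 0)) +
    tau * (n%:R * (gap / K * \sum_j enorm (B *m delta_mx j 0))) = gap / K * (K - 1).
    by rewrite /K; ring.
  by rewrite mulrBr divfK ?gt_eqF // mulr1 ltrBlDr ltrDl.
have tB' : tau * enorm (B *m x) <= tau * enorm (B *m y) + tau * enorm (B *m (x - y)).
  by rewrite -mulrDr ler_pM2l.
have hB' : tau * enorm (B *m (x - y)) <= tau * (n%:R * (gap / K * \sum_j enorm (B *m delta_mx j 0))).
  by rewrite ler_pM2l.
move: small hA hB' tA tB'.
move: (n%:R * (gap / K * _)) (tau * (n%:R * _)) => S1 S2; rewrite /gap.
move: (enorm (A *m y)) (tau * enorm (B *m y)) (tau * enorm (B *m (x - y)))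
  (enorm (A *m (x - y))) (enorm (A *m x)) (tau * enorm (B *m x)) => *; lra.
Qed.

Lemma measurable_exists_lt n m1 m2 (A : T -> 'M[R]_(m1, n)) (B : T -> 'M[R]_(m2, n)) tau :
  0 < tau -> (forall i j, measurable_fun setT (fun w => A w i j)) ->
  (forall i j, measurable_fun setT (fun w => B w i j)) ->
  measurable [set w | exists x, enorm (A w *m x) < tau * enorm (B w *m x)].
Proof.
move=> tau0 mA mB.
have -> : [set w | exists x, enorm (A w *m x) < tau * enorm (B w *m x)] =
    \bigcup_q [set w | enorm (A w *m map_mx ratr (q : 'cV[rat]_n))
      < tau * enorm (B w *m map_mx ratr q)].
  apply/seteqP; split => w /= => [/(rat_vector_witness tau0)[q hq]|[q _ hq]].
    by exists q.
  by exists (map_mx ratr q).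
apply: countable_bigcupT_measurable => // q; apply: measurable_lt_set.
  by apply: enorm_measurable; apply: measurable_enorm_mulmx.
apply: measurable_funM => //.
by apply: enorm_measurable; apply: measurable_enorm_mulmx.
Qed.

End Measurability.

(** * Runs of the algorithm *)

Section Run.
Context {R : realType} {d : measure_display} {T : measurableType d}
  (Pr : probability T R) {n s : nat}.
Variables (f : 'cV[R]_n -> R) (x0 : 'cV[R]_n) (de Del : R)
  (P : nat -> T -> 'M[R]_(s, n)) (z : nat -> T -> 'cV[R]_(s + 1))
  (x : nat -> T -> 'cV[R]_n).
Hypothesis run : RSHTR_run Pr f x0 de Del P z x.
Hypotheses (s0 : (0 < s)%N) (fC2 : C2 f).

(* Unlike x, defined and measurable at every iteration, reached or not. *)
Fixpoint iterate (k : nat) (w : T) : 'cV[R]_n :=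
  if k is j.+1 then iterate j w +
    (Del / enorm (direction (P j w) (z j w))) *: direction (P j w) (z j w)
  else x0.

Lemma reached_iterate k w : reached Del P z k w -> x k w = iterate k w.
Proof.
elim: k => [_|k IH rk]; first exact: run_start run w.
rewrite (run_step run rk) /= IH // => j jk; apply: rk; exact: ltnW.
Qed.

Let past_gen k : set (set T) :=
  \bigcup_(j in [set j | (j < k)%N]) (sigma_mx (P j) `|` sigma_mx (z j)).
Let mx_gen (m1 m2 : nat) (X : T -> 'M[R]_(m1, m2)) : set (set T) :=
  [set A | exists i j, exists2 B : set R,
     measurable B & A = (fun w => X w i j) @^-1` B].

Let sigma_mx_measurable m1 m2 (X : T -> 'M[R]_(m1, m2)) :
  (forall i j, measurable_fun setT (fun w => X w i j)) ->
  sigma_mx X `<=` measurable /\ mx_gen X `<=` measurable.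
Proof.
move=> mX; have m : mx_gen X `<=` measurable.
  by move=> _ [i [j [B mB ->]]]; have := mX i j measurableT B mB; rewrite setTI.
by split => //; exact: g_sigma_sub_measurable.
Qed.

Let P_measurable k i j : measurable_fun setT (fun w => P k w i j).
Proof. by case: (run_gaussian run k) => h _ _; exact: h. Qed.

Let past_gen_measurable k : past_gen k `<=` measurable.
Proof.
move=> A [j _ [sA|sA]].
  by apply: (sigma_mx_measurable (P_measurable j)).1.
apply: (sigma_mx_measurable _).1 sA => i i'; rewrite (ord1 i').
exact: run_measurable run j i.
Qed.

Let P_past k j i i' : (j < k)%N ->
  measurable_fun setT ((fun w => P j w i i') : g_sigma_algebraType (past_gen k) -> R).
Proof.
move=> jk _ B mB; rewrite setTI; apply: sub_sigma_algebra; exists j => //; left.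
by apply: sub_sigma_algebra; exists i, i', B.
Qed.

Let z_past k j i i' : (j < k)%N ->
  measurable_fun setT ((fun w => z j w i i') : g_sigma_algebraType (past_gen k) -> R).
Proof.
move=> jk _ B mB; rewrite setTI; apply: sub_sigma_algebra; exists j => //; right.
by apply: sub_sigma_algebra; exists i, i', B.
Qed.

Let direction_past k j i : (j < k)%N ->
  measurable_fun setT ((fun w => direction (P j w) (z j w) i 0) :
    g_sigma_algebraType (past_gen k) -> R).
Proof.
move=> jk; pose S := g_sigma_algebraType (past_gen k).
pose t (w : S) : R := z j w (rshift s 0) 0.
have mt : measurable_fun setT t by exact: z_past.
pose y (w : S) : R := ((P j w)^T *m usubmx (z j w)) i 0.
have my : measurable_fun setT y.
  apply: (@measurable_enorm_mulmx _ _ S _ _ (fun w => (P j w)^T) (fun w => usubmx (z j w))).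
    by move=> a b; under eq_fun do rewrite mxE; exact: P_past.
  by move=> a; under eq_fun do rewrite mxE; exact: z_past.
have -> : (fun w => direction (P j w) (z j w) i 0) =
    (fun w : S => (if t w == 0 then 1 else (t w)^-1) * y w).
  apply/funext => w; rewrite /direction /t /y [dsubmx _ _ _]mxE.
  by case: eqP => _ /=; rewrite ?mul1r // mxE.
apply: measurable_funM => //; apply: measurable_fun_ifT => //.
  exact: measurable_fun_eqr.
exact: (measurableT_comp measurable_inv mt).
Qed.

Lemma iterate_past k i :
  measurable_fun setT ((fun w => iterate k w i 0) : g_sigma_algebraType (past_gen k) -> R).
Proof.
suff H j : (j <= k)%N -> forall i,
    measurable_fun setT ((fun w => iterate j w i 0) : g_sigma_algebraType (past_gen k) -> R).
  exact: H.
elim: j => [_ i'|j IH jk i']; first exact: measurable_cst.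
under eq_fun do rewrite !mxE.
apply: measurable_funD; first by apply: IH; exact: ltnW.
apply: measurable_funM; last exact: direction_past.
apply: measurable_funM => //.
apply: (@measurableT_comp _ _ _ _ _ _ (@GRing.inv R)); first exact: measurable_inv.
apply: (@enorm_measurable _ _ (g_sigma_algebraType (past_gen k))) => i''.
exact: direction_past.
Qed.

(** The event of interest is the diagonal of [D], with past and current draw read at the same
    outcome; independence reduces it to sections where the past is frozen. *)
Let past_pair k (D : set (g_sigma_algebraType (past_gen k) *
    g_sigma_algebraType (mx_gen (P k)))) (p : \bar R) :
  measurable D -> (forall w1, Pr [set w2 | D (w1, w2)] <= p)%E ->
  (Pr [set w | D (w, w)] <= p)%E /\ measurable [set w : T | D (w, w)].
Proof.
have mP := (sigma_mx_measurable (P_measurable k)).2.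
have i1 := measurable_id_g_sigma (@past_gen_measurable k).
have i2 := measurable_id_g_sigma mP.
move=> mD pD; split; last first.
  by have := measurable_fun_pair i1 i2 measurableT mD; rewrite setTI.
pose X1 : {mfun T >-> g_sigma_algebraType (past_gen k)} :=
  HB.pack (id : T -> g_sigma_algebraType (past_gen k)) (isMeasurableFun.Build _ _ _ _ _ i1).
pose X2 : {mfun T >-> g_sigma_algebraType (mx_gen (P k))} :=
  HB.pack (id : T -> g_sigma_algebraType (mx_gen (P k))) (isMeasurableFun.Build _ _ _ _ _ i2).
have ind : forall A B, measurable A -> measurable B ->
    Pr (X1 @^-1` A `&` X2 @^-1` B) = (Pr (X1 @^-1` A) * Pr (X2 @^-1` B))%E.
  by move=> A B mA mB; exact: (run_indep run (k := k) mA mB).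
exact: (indep_le_section ind mD pD).
Qed.

Let hess_past k i j : measurable_fun setT
  ((fun w => hess f (iterate k w) i j) : g_sigma_algebraType (past_gen k) -> R).
Proof.
apply: (@measurable_continuous_comp _ _ (g_sigma_algebraType (past_gen k)) n
  (fun y => hess f y i j) (iterate k)); last by move=> i'; exact: iterate_past.
have [_ _ cH] := fC2; move=> y.
apply: (@continuous_comp _ _ _ (hess f) (fun N : 'M[R]_n => N i j)); first exact: cH.
exact: coord_continuous.
Qed.

Let grad_past k i : measurable_fun setT
  ((fun w => grad f (iterate k w) i 0) : g_sigma_algebraType (past_gen k) -> R).
Proof.
apply: (@measurable_continuous_comp _ _ (g_sigma_algebraType (past_gen k)) n
  (fun y => grad f y i 0) (iterate k)); last by move=> i'; exact: iterate_past.
have [_ dg _] := fC2; move=> y.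
apply: (@continuous_comp _ _ _ (grad f) (fun N : 'cV[R]_n => N i 0)).
  exact: differentiable_continuous.
exact: coord_continuous.
Qed.

Let P_gen k i j : measurable_fun setT
  ((fun w => P k w i j) : g_sigma_algebraType (mx_gen (P k)) -> R).
Proof. by move=> _ B mB; rewrite setTI; apply: sub_sigma_algebra; exists i, j, B. Qed.

Lemma gradient_shrunk_le k (al : R) : 0 < al ->
  let A := [set w | enorm (P k w *m grad f (iterate k w)) < al * enorm (grad f (iterate k w))] in
  measurable A /\ (Pr A <= ((2 * al) ^+ s)%:E)%E.
Proof.
move=> al0 A.
pose D : set (g_sigma_algebraType (past_gen k) * g_sigma_algebraType (mx_gen (P k))) :=
  [set p | enorm (P k p.2 *m grad f (iterate k p.1)) < al * enorm (grad f (iterate k p.1))].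
have mg i : measurable_fun setT (fun p : g_sigma_algebraType (past_gen k) *
    g_sigma_algebraType (mx_gen (P k)) => grad f (iterate k p.1) i 0).
  exact: (measurableT_comp (@grad_past k i) measurable_fst).
have mD : measurable D.
  apply: measurable_lt_set; last first.
    by apply: measurable_funM => //; apply: enorm_measurable.
  apply: enorm_measurable; apply: measurable_enorm_mulmx => // i j.
  exact: (measurableT_comp (@P_gen k i j) measurable_snd).
suff pD w1 : (Pr [set w2 | D (w1, w2)] <= ((2 * al) ^+ s)%:E)%E.
  by have [] := past_pair mD pD.
rewrite /D /=; move: (grad f (iterate k w1)) => g.
have Pg := run_gaussian run k.
(* The inequality defining the event is strict, so a zero gradient never belongs to it. *)
have [->|g0] := eqVneq g 0.
  rewrite (_ : [set w2 | _] = set0) ?measure0 ?lee_fin ?exprn_ge0 ?mulr_ge0 ?ltW //.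
  by apply/seteqP; split => w2 //=; rewrite mulmx0 !enorm0 mulr0 ltxx.
apply: le_trans (gaussian_small_ball s0 Pg g0 al0); apply: le_measure; rewrite ?inE.
- apply: measurable_lt_set => //; exact: (gaussian_enorm_measurable Pg).
- exact: (gaussian_le_measurable Pg).
- by move=> w /= /ltW.
Qed.

(** The rank condition is part of the event because the estimate for a frozen Hessian is available
    only up to rank [s]; sections with larger rank are empty. *)
Lemma range_shrunk_le k (tau eta : R) : 0 < tau -> 0 <= eta ->
  (forall H : 'M[R]_n, (\rank H <= s)%N -> exists E : set T,
    [/\ measurable E, (Pr E <= eta%:E)%E &
      forall w, ~ E w -> forall y, tau * enorm (H *m y) <= enorm (P k w *m (H *m y))]) ->
  let A := [set w | (\rank (hess f (iterate k w)) <= s)%N /\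
    exists y, enorm (P k w *m hess f (iterate k w) *m y)
              < tau * enorm (hess f (iterate k w) *m y)] in
  measurable A /\ (Pr A <= eta%:E)%E.
Proof.
move=> tau0 eta0 HE A.
pose D : set (g_sigma_algebraType (past_gen k) * g_sigma_algebraType (mx_gen (P k))) :=
  [set p | (\rank (hess f (iterate k p.1)) <= s)%N] `&`
  [set p | exists y, enorm (P k p.2 *m hess f (iterate k p.1) *m y)
              < tau * enorm (hess f (iterate k p.1) *m y)].
have mH i j : measurable_fun setT (fun p : g_sigma_algebraType (past_gen k) *
    g_sigma_algebraType (mx_gen (P k)) => hess f (iterate k p.1) i j).
  exact: (measurableT_comp (@hess_past k i j) measurable_fst).
have mD : measurable D.
  apply: measurableI; first exact: measurable_rank_le.
  apply: measurable_exists_lt => // i j; under eq_fun do rewrite mxE.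
  apply: measurable_sum => l; apply: measurable_funM => //.
  exact: (measurableT_comp (@P_gen k i l) measurable_snd).
suff pD w1 : (Pr [set w2 | D (w1, w2)] <= eta%:E)%E.
  by have [] := past_pair mD pD.
rewrite /D /=; move: (hess f (iterate k w1)) => H.
have [rH|rH] := boolP (\rank H <= s)%N; last first.
  rewrite (_ : [set w2 | _] = set0) ?measure0 ?lee_fin //.
  by apply/seteqP; split => w2 //= -[].
have [E [mE pE EP]] := HE H rH; apply: (le_trans _ pE); apply: le_measure; rewrite ?inE //.
- rewrite (_ : [set w2 | _] = [set w2 | exists y, enorm (P k w2 *m H *m y) < tau * enorm (H *m y)]).
    apply: measurable_exists_lt => // i j; under eq_fun do rewrite mxE.
    by apply: measurable_sum => l; apply: measurable_funM.
  by apply/seteqP; split => w2 /=; [case|].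
- move=> w [_ [y hy]]; apply: contrapT => nE; move: hy.
  by rewrite -mulmxA ltNge EP.
Qed.

End Run.

(** * Conclusion *)

Section Assembly.
Context {R : realType}.

Lemma lambda_min_ge n (A : 'M[R]_n) (c : R) : 0 <= c ->
  (forall a, eigenvalue A a -> - c <= a) -> - c <= lambda_min A.
Proof.
move=> c0 h; rewrite /lambda_min; set S := [set a : R | _].
(* The infimum of the empty set is 0 by convention, whence the assumption 0 <= c. *)
have [S0|/set0P S0] := eqVneq S set0; first by rewrite S0 inf0 oppr_le0.
by apply: lb_le_inf => // a; exact: h.
Qed.

Lemma eigenvalue_col n (A : 'M[R]_n) (a : R) : A^T = A -> eigenvalue A a ->
  exists2 q : 'cV[R]_n, q != 0 & A *m q = a *: q.
Proof.
move=> Asym /eigenvalueP[v vA v0]; exists v^T.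
  by apply: contra v0 => /eqP h; apply/eqP; rewrite -[v]trmxK h trmx0.
by rewrite -{1}Asym -trmx_mul vA linearZ.
Qed.

Lemma opnorm_ge0 m n (A : 'M[R]_(m, n)) (i : 'I_n) : 0 <= opnorm A.
Proof.
have h := enorm_mulmx_opnorm A (delta_mx i 0); rewrite enorm_delta mulr1 in h.
exact: le_trans (enorm_ge0 _) h.
Qed.

Lemma powR_neg32 (eps : R) : 0 < eps -> eps `^ (- (3 / 2)) = (Num.sqrt eps ^+ 3)^-1.
Proof.
move=> e0; rewrite powRN -powR12_sqrt ?ltW // -powR_mulrn ?powR_ge0 // -powRrM.
by congr (_ `^ _)^-1; rewrite mulrC.
Qed.

Lemma sqrt_le_powR (c nu eps tau : R) : 0 < c -> 0 < nu -> 0 < eps -> 0 < tau ->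
  1 <= c * nu * eps `^ tau^-1 ->
  Num.sqrt eps <= c `^ (tau / 2) * nu `^ (tau / 2) * eps.
Proof.
move=> c0 nu0 e0 t0 h.
have [c0' nu0' e0'] : [/\ 0 <= c, 0 <= nu & 0 <= eps] by rewrite !ltW.
have t2 : 0 <= tau / 2 by rewrite divr_ge0 // ltW.
have : 1 <= (c * nu * eps `^ tau^-1) `^ (tau / 2).
  apply: (@le_trans _ _ (1 `^ (tau / 2))); first by rewrite powR1.
  rewrite ge0_ler_powR ?nnegrE //.
  exact: le_trans ler01 h.
rewrite !powRM ?mulr_ge0 ?powR_ge0 // -powRrM mulrA mulVf ?gt_eqF // mul1r powR12_sqrt //.
move=> h1; have := ler_wpM2r (sqrtr_ge0 eps) h1.
rewrite mul1r => h2; apply: (le_trans h2).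
by rewrite -{3}(sqr_sqrtr e0') expr2 mulrA.
Qed.

End Assembly.

Section RunDescent.
Context {R : realType} {d : measure_display} {T : measurableType d}
  (Pr : probability T R) {n s : nat}.
Variables (f : 'cV[R]_n -> R) (x0 : 'cV[R]_n) (M e b de Del : R)
  (P : nat -> T -> 'M[R]_(s, n)) (z : nat -> T -> 'cV[R]_(s + 1))
  (x : nat -> T -> 'cV[R]_n).
Hypothesis run : RSHTR_run Pr f x0 de Del P z x.
Hypotheses (fC2 : C2 f) (M0 : 0 < M)
  (hess_lip : forall y1 y2, opnorm (hess f y1 - hess f y2) <= M * enorm (y1 - y2)).
Hypotheses (e0 : 0 < e) (b1 : 1 <= b) (deE : de = b ^+ 2 * e) (DelE : Del = e / M).

Lemma reached_descent k w : reached Del P z k w ->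
  (forall j, (j < k)%N -> forall y, enorm ((P j w)^T *m y) <= b * enorm y) ->
  f (x k w) <= f x0 - k%:R * (e ^+ 3 / (3 * M ^+ 2)).
Proof.
elim: k => [_ _|k IH rk Pb]; first by rewrite (run_start run) mul0r subr0.
have rk' : reached Del P z k w by move=> j jk; apply: rk; exact: ltnW.
have := IH rk' (fun j jk => Pb j (ltnW jk)).
have := descent_step fC2 M0 hess_lip e0 b1 deE DelE (Pb k (ltnSn k))
  (run_minimizer run rk') (rk k (ltnSn k)).
rewrite -(run_step run rk) -[k.+1%:R]natr1 [(_ + 1) * _]mulrDl mul1r.
move: (f _) (f (x k w)) (f x0) => a1 a2 a3.
move: (e ^+ 3 / _) => a5; move: (k%:R * a5) => a4 h1 h2; lra.
Qed.

(** N steps without stopping would take f below its infimum. The first index that passes the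
    stopping test is the output. *)
Lemma outputs_before (N : nat) w : has_lbound (range f) ->
  3 * M ^+ 2 * (f x0 - inf (range f)) / e ^+ 3 < N%:R ->
  (forall j, (j < N)%N -> forall y, enorm ((P j w)^T *m y) <= b * enorm y) ->
  exists2 k, (k < N)%N & outputs_at Del P z k w.
Proof.
move=> lbf NU Pb.
pose stop j := enorm (direction (P j w) (z j w)) <= Del.
have [[k kN sk]|nostop] := pselect (exists2 k, (k < N)%N & stop k).
  have ex : exists k, stop k by exists k.
  have [m sm min] := ex_minnP ex; exists m; first by apply: leq_ltn_trans kN; exact: min.
  split => // j jm; rewrite ltNge; apply/negP => /min; rewrite leqNgt jm //.
exfalso; have rN : reached Del P z N w.
  by move=> j jN; rewrite ltNge; apply/negP => h; apply: nostop; exists j.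
have := reached_descent rN Pb.
have : inf (range f) <= f (x N w) by apply: ge_inf => //; exists (x N w).
have e3 : 0 < e ^+ 3 by rewrite exprn_gt0.
have M2 : 0 < M ^+ 2 by rewrite exprn_gt0.
move=> h1 h2; move: NU; rewrite ltr_pdivrMr // ltNge => /negP; apply.
have : N%:R * (e ^+ 3 / (3 * M ^+ 2)) <= f x0 - inf (range f).
  by move: (e ^+ 3 / _) h2 => a5 h2; move: (N%:R * a5) (f (x N w)) h1 h2 => a2 a1 h1 h2; lra.
by rewrite mulrA ler_pdivrMr ?mulr_gt0 // [_ * (3 * _)]mulrC.
Qed.

End RunDescent.

Section Outcome.
Context {R : realType}.

Lemma prob_ge_setC {d : measure_display} {T : measurableType d}
    (Pr : probability T R) (A B : set T) (p q : R) :
  measurable B -> (Pr B <= p%:E)%E -> q <= 1 - p -> ~` B `<=` A -> prob_ge Pr A q.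
Proof.
move=> mB pB qp BA; exists (~` B); split => //; first exact: measurableC.
have [b bE] : exists b, Pr B = b%:E.
  by exists (fine (Pr B)); rewrite fineK // fin_num_measure.
rewrite probability_setC // bE -EFinB lee_fin; rewrite bE lee_fin in pB.
by move: pB qp; lra.
Qed.

Lemma output_is_sosp n s (f : 'cV[R]_n -> R) (M L e CC nu de Del al tau : R) (x : 'cV[R]_n)
    (P : 'M[R]_(s, n)) (z : 'cV[R]_(s + 1)) : C2 f -> 0 < M ->
  (forall y1 y2, opnorm (hess f y1 - hess f y2) <= M * enorm (y1 - y2)) ->
  0 <= L -> (forall y1 y2, enorm (grad f y1 - grad f y2) <= L * enorm (y1 - y2)) ->
  0 < e -> e ^+ 2 <= M ^+ 2 / 8 -> 0 < CC -> 2 * CC + 2 <= Num.sqrt nu -> 0 <= nu ->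
  de = (Num.sqrt nu + CC) ^+ 2 * e -> Del = e / M ->
  (forall y, (Num.sqrt nu - CC) * enorm y <= enorm (P^T *m y)
             <= (Num.sqrt nu + CC) * enorm y) ->
  ball_minimizer (sub_mx (grad f x) (hess f x) de P) z ->
  enorm (direction P z) <= Del -> 0 < al -> 0 < tau ->
  al * enorm (grad f x) <= enorm (P *m grad f x) ->
  (forall y, tau * enorm (hess f x *m y) <= enorm (P *m (hess f x *m y))) ->
  enorm (grad f x) <= 3 * (1 + L / M) / al * nu * e /\
  - (6 * (1 + L / M) / tau ^+ 2 * nu * e) <= lambda_min (hess f x).
Proof.
move=> fC2 M0 hlip L0 glip e0 eM CC0 nuCC nu0 deE DelE Pn zmin dD al0 tau0 galow rlow.
set sn := Num.sqrt nu in nuCC deE Pn.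
have sn2 : sn ^+ 2 = nu by rewrite sqr_sqrtr.
have Pb y : enorm (P^T *m y) <= (sn + CC) * enorm y by have /andP[] := Pn y.
have Pa y : (sn - CC) * enorm y <= enorm (P^T *m y) by have /andP[] := Pn y.
have b1 : 1 <= sn + CC by lra.
have a1 : 1 <= sn - CC by lra.
(* CC <= sn/2, hence sn + CC <= (3/2) sn. *)
have bnu : (sn + CC) ^+ 2 <= 9 / 4 * nu.
  rewrite -sn2 (_ : 9 / 4 * sn ^+ 2 = (3 / 2 * sn) ^+ 2); last by field.
  by rewrite lerXn2r ?nnegrE; lra.
(* This is where eps <= M^2/8 enters: Del^2 = eps / M^2 <= 1/8. *)
have Del_half : Del <= 2^-1.
  rewrite DelE -(@ler_pXn2r _ 2) ?nnegrE ?divr_ge0 ?(ltW e0) ?(ltW M0) //.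
  rewrite expr_div_n ler_pdivrMr ?exprn_gt0 //.
  have M2 : 0 <= M ^+ 2 by exact: sqr_ge0.
  by apply: (le_trans eM); rewrite exprVn mulrC ler_wpM2r // lef_pV2 ?posrE //; lra.
have [gb [th [th0 thub psd]]] := termination_bounds fC2 M0 hlip e0 b1 deE DelE Pb zmin
  a1 L0 bnu Pa glip Del_half dD.
split.
  have := le_trans galow gb; rewrite -ler_pdivlMl // => h; apply: (le_trans h).
  by rewrite le_eqVlt; apply/orP; left; apply/eqP; ring.
have LM : 0 <= 1 + L / M by rewrite addr_ge0 // divr_ge0 // ltW.
have Hsym := hess_sym fC2 (ltW M0) hlip x.
apply: lambda_min_ge => [|a].
  by rewrite !mulr_ge0 ?invr_ge0 ?sqr_ge0 ?(ltW e0).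
move=> /(eigenvalue_col Hsym)[q q0 Hq].
apply: le_trans (eigenvalue_compress Hsym tau0 th0 rlow psd q0 Hq).
rewrite lerN2 ler_pdivrMr ?exprn_gt0 //; apply: (le_trans thub).
by rewrite le_eqVlt; apply/orP; left; apply/eqP; field; rewrite !gt_eqF.
Qed.

End Outcome.

Theorem theorem3p2 (R : realType) (CC C Cbar cbar : R)
  (hCC : 0 < CC) (hC : 0 < C) (hCbar : 0 < Cbar) (hcbar : 0 < cbar)
  (CC_norm : norm_constant CC) (C_JL : JL_constant C)
  (Cbar_RV : RV_constants Cbar cbar) :
  exists kappa : R, CC < Num.sqrt kappa /\
  exists (Kiter : R -> R -> R) (K : R -> R -> R -> R -> R)
    (K' : R -> R -> nat -> nat -> R),
  forall (n s : nat) (f : 'cV[R]_n -> R) (L M eps c tau : R) (x0 : 'cV[R]_n)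
    (r : nat)
    (d : measure_display) (T : measurableType d) (Pr : probability T R)
    (P : nat -> T -> 'M[R]_(s, n)) (z : nat -> T -> 'cV[R]_(s + 1))
    (x : nat -> T -> 'cV[R]_n),
  let nu : R := n%:R / s%:R in
  let delta := (Num.sqrt nu + CC) ^+ 2 * Num.sqrt eps in
  let Delta := Num.sqrt eps / M in
  let finf := inf (range f) in
  let U : R :=
    (Num.floor (3 * M ^+ 2 * (f x0 - finf) * eps `^ (- (3 / 2))))%:~R + 1 in
  (0 < s)%N -> kappa <= nu ->
  C2 f -> has_lbound (range f) ->
  (forall y1 y2, enorm (grad f y1 - grad f y2) <= L * enorm (y1 - y2)) ->
  (forall y1 y2, opnorm (hess f y1 - hess f y2) <= M * enorm (y1 - y2)) ->
  0 < eps <= M ^+ 2 / 8 ->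
  0 < tau -> 0 < c -> s%:R <= c * n%:R * eps `^ tau^-1 ->
  RSHTR_run Pr f x0 delta Delta P z x ->
  (r <= s)%N ->
  {ae Pr, forall w, forall k, outputs_at Delta P z k w ->
     (\rank (hess f (x k w)) <= r)%N} ->
  prob_ge Pr
    [set w | exists k : nat,
       [/\ outputs_at Delta P z k w,
           k.+1%:R <= Kiter M (f x0 - finf) * eps `^ (- (3 / 2)),
           enorm (grad f (x k w)) <= K L M tau c * nu `^ ((2 + tau) / 2) * eps
         & - (K' L M (\rank (hess f (x k w))) s * nu * Num.sqrt eps)
             <= lambda_min (hess f (x k w))]]
    (1 - 6 * expR (- (C * s%:R / 4)) - (2 * U + 4) * expR (- s%:R)
       - expR (- s%:R + r%:R - 1) - expR (- (cbar * s%:R))).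
Proof.
(* [K'] has to be fixed before [n] and the run, so the shrinking factor is first chosen as a
   function of [s], at failure level e^(-2s). *)
have [tauf tauf_pos tauf_range] : exists2 tauf : nat -> R, (forall s, 0 < tauf s) &
    forall s n (d : measure_display) (T : measurableType d) (Pr : probability T R)
      (P : T -> 'M[R]_(s, n)) (H : 'M[R]_n),
    (0 < s)%N -> gaussian_mx Pr P -> (\rank H <= s)%N ->
    exists E : set T, [/\ measurable E, (Pr E <= (expR (s%:R * - 2))%:E)%E &
      forall w, ~ E w -> forall y, tauf s * enorm (H *m y) <= enorm (P w *m (H *m y))].
  have H s : exists t : R, 0 < t /\ forall n (d : measure_display) (T : measurableType d)
      (Pr : probability T R) (P : T -> 'M[R]_(s, n)) (H : 'M[R]_n),
      (0 < s)%N -> gaussian_mx Pr P -> (\rank H <= s)%N ->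
      exists E : set T, [/\ measurable E, (Pr E <= (expR (s%:R * - 2))%:E)%E &
        forall w, ~ E w -> forall y, t * enorm (H *m y) <= enorm (P w *m (H *m y))].
    case: (posnP s) => [->|s0]; first by exists 1; split.
    have [t t0 ht] := gaussian_range_small_ball s0 (expR_gt0 (s%:R * - 2 : R)).
    by exists t; split => // n d T Pr P H _; exact: ht.
  have [tauf htau] := choice H.
  by exists tauf => s; [case: (htau s)|case: (htau s)].
(* With this value the small ball bound (2 al)^s equals e^(-2s). *)
pose al : R := expR (- 2) / 2.
have al0 : 0 < al by rewrite divr_gt0 ?expR_gt0.
have kap : Num.sqrt ((2 * CC + 2) ^+ 2) = 2 * CC + 2 by rewrite sqrtr_sqr ger0_norm //; lra.
(* sqrt nu >= 2 CC + 2 keeps sqrt nu - CC above 1 and makes CC at most half of sqrt nu. *)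
exists ((2 * CC + 2) ^+ 2); split; first by rewrite kap; lra.
(* The second summand pays for the extra iteration in floor + 1: times eps^(-3/2) it is at least 1,
   because eps <= M^2/8. *)
exists (fun M gap => 3 * M ^+ 2 * gap + Num.sqrt (M ^+ 2 / 8) ^+ 3).
exists (fun L M tau c => 3 * (1 + L / M) / al * c `^ (tau / 2)).
exists (fun L M _ s => 6 * (1 + L / M) / tauf s ^+ 2).
move=> n s f L M eps c tau x0 r d T Pr P z x nu de Del finf U s0 knu fC2 flb glip hlip.
move=> /andP[eps0 epsM] tau0 c0 sle run rs aerank.
have sR0 : 0 < s%:R :> R by rewrite ltr0n.
have nuCC : 2 * CC + 2 <= Num.sqrt nu.
  by rewrite -kap ler_wsqrtr.
have nu1 : 1 <= nu.
  apply: le_trans knu; rewrite -[leLHS](expr1n _ 2) lerXn2r ?nnegrE //; lra.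
have nu0 : 0 < nu by apply: lt_le_trans nu1.
have sn : (0 < s <= n)%N.
  by rewrite s0 /= -(ler_nat R); move: nu1; rewrite /nu ler_pdivlMr // mul1r.
pose i0 : 'I_n := Ordinal (leq_trans s0 (andP sn).2).
set e := Num.sqrt eps.
have e0 : 0 < e by rewrite sqrtr_gt0.
have e2 : e ^+ 2 = eps by rewrite sqr_sqrtr // ltW.
have dlt : 0 < enorm (delta_mx i0 0 - 0 : 'cV[R]_n) by rewrite subr0 enorm_delta.
(* M = 0 contradicts 0 < eps <= M^2/8; the sign follows from the Lipschitz bound at two distinct
   points. *)
have M0 : 0 < M.
  rewrite lt0r; apply/andP; split.
    by apply: contraTneq epsM => ->; rewrite expr0n mul0r -ltNge.
  have := le_trans (opnorm_ge0 _ i0) (hlip (delta_mx i0 0) 0).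
  by rewrite pmulr_lge0.
have L0 : 0 <= L.
  have := le_trans (enorm_ge0 _) (glip (delta_mx i0 0) 0).
  by rewrite pmulr_lge0.
have e3 : 0 < e ^+ 3 by rewrite exprn_gt0.
set A := 3 * M ^+ 2 * (f x0 - finf) * eps `^ (- (3 / 2)) in U *.
have AE : A = 3 * M ^+ 2 * (f x0 - finf) / e ^+ 3 by rewrite /A powR_neg32.
have gap0 : 0 <= f x0 - finf by rewrite subr_ge0 /finf; apply: ge_inf => //; exists x0.
have A0 : 0 <= A by rewrite AE divr_ge0 ?(ltW e3) // mulr_ge0 // mulr_ge0 // sqr_ge0.
pose N := (Num.truncn A).+1.
have UN : U = N%:R.
  by rewrite /U /N -[RHS]natr1 truncn_floor A0 natr_absz ger0_norm // floor_ge0.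
have /andP[AN1 AN2] := truncn_itv A0.
have p0 (y : R) := expR_ge0 y.
have pU : 0 <= U by rewrite UN.
(* In the first case the claimed probability is not positive, and the empty event will do. *)
have [vac|nonvac] := leP 1 (2 * U * expR (- s%:R)).
  exists set0; split => //; rewrite measure0 lee_fin.
  by have := p0 (- (C * s%:R / 4)); have := p0 (- s%:R + r%:R - 1);
     have := p0 (- (cbar * s%:R)); have := p0 (- s%:R); lra.
have normE j := CC_norm n s d T Pr (P j) sn (run_gaussian run j).
have [Nm hNm] := choice normE.
pose G j := [set w | enorm (P j w *m grad f (iterate x0 Del P z j w))
   < al * enorm (grad f (iterate x0 Del P z j w))].
pose Rg j := [set w | (\rank (hess f (iterate x0 Del P z j w)) <= s)%N /\
    exists y, enorm (P j w *m hess f (iterate x0 Del P z j w) *m y)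
              < tauf s * enorm (hess f (iterate x0 Del P z j w) *m y)].
pose es := expR (- s%:R) : R; pose e2s := expR (s%:R * - 2) : R.
have hG j : measurable (G j) /\ (Pr (G j) <= e2s%:E)%E.
  have [mG pG] := gradient_shrunk_le run s0 fC2 j al0; split => //.
  by move: pG; rewrite /al mulrCA divff // mulr1 -expRM_natl.
have hR j : measurable (Rg j) /\ (Pr (Rg j) <= e2s%:E)%E.
  apply: (range_shrunk_le run fC2 (tauf_pos s) (expR_ge0 _)) => H rH.
  exact: tauf_range (run_gaussian run j) rH.
pose B (j : 'I_N) : set T := ~` Nm j `|` G j `|` Rg j.
have mB (j : 'I_N) : xpredT j -> measurable (B j).
  move=> _; have [mN _ _] := hNm j.
  apply: measurableU; last exact: (hR j).1.
  by apply: measurableU; [exact: measurableC|exact: (hG j).1].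
have pB (j : 'I_N) : xpredT j -> (Pr (B j) <= (2 * es + 2 * e2s)%:E)%E.
  move=> _; have [mN _ pN] := hNm j.
  have pNC : (Pr (~` Nm j) <= (2 * es)%:E)%E.
    have [b bE] : exists b, Pr (Nm j) = b%:E.
      by exists (fine (Pr (Nm j))); rewrite fineK // fin_num_measure.
    rewrite probability_setC // bE -EFinB lee_fin; rewrite bE lee_fin in pN.
    by move: pN; rewrite /es; lra.
  have -> : 2 * es + 2 * e2s = 2 * es + e2s + e2s by lra.
  rewrite !EFinD; apply: (le_trans (measureU2 _ _ _)); last apply: leeD.
  - apply: measurableU; [exact: measurableC|exact: (hG j).1].
  - exact: (hR j).1.
  - apply: (le_trans (measureU2 _ _ _)); last apply: leeD => //.
    + exact: measurableC.
    + exact: (hG j).1.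
    + exact: (hG j).2.
  - exact: (hR j).2.
have [mBU pBU] := prob_finite_union_le mB pB.
have [Nul [mNul pNul hNul]] := aerank.
apply: (@prob_ge_setC _ _ _ _ _ (\bigcup_(j in [set` xpredT]) B j `|` Nul)
  (U * (2 * es + 2 * e2s))).
- exact: measurableU.
- apply: (le_trans (measureU2 _ _ _)) => //; rewrite -[leRHS]adde0; apply: leeD.
    by move: pBU; rewrite card_ord UN.
  by rewrite le_eqVlt; apply/orP; left; exact/eqP.
(* The bad event costs 2U es + 2U es^2, and 2U es < 1 makes the second term at most es. *)
- have e2sE : e2s = es * es by rewrite /e2s /es -expRD; congr expR; lra.
  rewrite e2sE -/es.
  have := p0 (- (C * s%:R / 4)); have := p0 (- s%:R + r%:R - 1).
  have := p0 (- (cbar * s%:R)).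
  have es0 : 0 <= es := p0 _.
  have : 2 * U * es * es <= 1 * es by rewrite ler_wpM2r // ltW.
  by lra.
move=> w nw.
have nB j : (j < N)%N -> ~ (~` Nm j `|` G j `|` Rg j) w.
  by move=> jN Bw; apply: nw; left; exists (Ordinal jN).
have nN j : (j < N)%N -> Nm j w.
  by move=> jN; apply: contrapT => h; apply: (nB j jN); left; left.
have Pn j : (j < N)%N -> forall y, (Num.sqrt nu - CC) * enorm y <= enorm ((P j w)^T *m y)
    <= (Num.sqrt nu + CC) * enorm y.
  by move=> jN; have [_ sub _] := hNm j; exact: sub (nN j jN).
have b1 : 1 <= Num.sqrt nu + CC by lra.
have [k kN out] : exists2 k, (k < N)%N & outputs_at Del P z k w.
  apply: (outputs_before run fC2 M0 hlip e0 b1 erefl erefl flb).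
    by rewrite -AE.
  by move=> j jN y; have /andP[] := Pn j jN y.
have [rk dk] := out; have xk := reached_iterate run rk.
have rank_k : (\rank (hess f (x k w)) <= s)%N.
  apply: (leq_trans _ rs); have : ~ Nul w by move=> h; apply: nw; right.
  by move/(contra_not (@hNul w)) => /contrapT; apply.
have gk : al * enorm (grad f (x k w)) <= enorm (P k w *m grad f (x k w)).
  rewrite leNgt; apply/negP => h; apply: (nB k kN); left; right.
  by rewrite /G /= -xk.
have hk y : tauf s * enorm (hess f (x k w) *m y) <= enorm (P k w *m (hess f (x k w) *m y)).
  rewrite leNgt; apply/negP => h; apply: (nB k kN); right.
  by rewrite /Rg /= -xk; split => //; exists y; rewrite -mulmxA.
have eM : e ^+ 2 <= M ^+ 2 / 8 by rewrite e2.
have [cg ch] := output_is_sosp fC2 M0 hlip L0 glip e0 eM hCC nuCC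
  (ltW nu0) erefl erefl (Pn k kN) (run_minimizer run rk) dk al0 (tauf_pos s) gk hk.
exists k; split => //.
  rewrite powR_neg32 // -/e mulrDl -AE.
  apply: (@le_trans _ _ N%:R); first by rewrite ler_nat.
  rewrite /N -[leLHS]natr1 lerD // ler_pdivlMr // mul1r.
  by rewrite lerXn2r ?nnegrE ?sqrtr_ge0 // ler_wsqrtr.
apply: (le_trans cg).
have eub : e <= c `^ (tau / 2) * nu `^ (tau / 2) * eps.
  apply: sqrt_le_powR => //; rewrite /nu mulrA mulrAC ler_pdivlMr // mul1r //.
have -> : nu `^ ((2 + tau) / 2) = nu * nu `^ (tau / 2).
  rewrite mulrDl divff // powRD ?powRr1 ?(ltW nu0) //.
  by apply/implyP => _; rewrite gt_eqF.
have k0 : 0 <= 3 * (1 + L / M) / al * nu.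
  have LM : 0 <= 1 + L / M by rewrite addr_ge0 // divr_ge0 // ltW.
  by rewrite !mulr_ge0 ?invr_ge0 ?(ltW al0) ?(ltW nu0).
apply: (le_trans (ler_wpM2l k0 eub)); rewrite le_eqVlt; apply/orP; left.
by apply/eqP; ring.
Qed.
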